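(* Let $M$ be a binary matroid with no minor isomorphic to $F_7^*$, $R_{10}$ or $M_{K_5}^*$, and such that its cycle polytope $P=C(M)$ is 2-level. Let $d$ be the dimension of $P$. Then $f_0(P)f_{d-1}(P)\leq d2^{d+1}$, and equality holds if and only if $P$ is affinely isomorphic to the $d$-dimensional cube or the $d$-dimensional cross-polytope.
   Context: For a $d$-dimensional polytope $P$, $f_0(P)$ is its number of vertices and $f_{d-1}(P)$ its number of facets. Convention for $d=0$: a point has no facets, so the product is $0$, and the $0$-dimensional cube and cross-polytope are points. The $d$-dimensional cube is $[-1,1]^d$ and the $d$-dimensional cross-polytope is its polar. A polytope $P$ is 2-level if for each facet $F$ of $P$ all vertices of $P$ not in $F$ lie in one common translate of the affine hull of $F$. A matroid is binary if it is representable over the two-element field $GF_2$. A cycle of a matroid $M$ with ground set $E$ is a set $C\subseteq E$ that is empty or a disjoint union of circuits; the cycle polytope $C(M)\subseteq\mathbb{R}^E$ is the convex hull of the characteristic vectors of the cycles of $M$. $F_7^*$ is the dual of the Fano matroid; $R_{10}$ is the binary matroid represented over $GF_2$ by the $5\times10$ matrix whose columns are the ten $0/1$ vectors with exactly three ones; $M_{K_5}^*$ is the dual of the forest (graphic) matroid of $K_5$. *)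

(* Defs.v *)
From mathcomp Require Import all_boot all_order all_algebra.
From mathcomp Require Import boolp.

Set Implicit Arguments.
Unset Strict Implicit.
Unset Printing Implicit Defensive.

Import Order.TTheory GRing.Theory Num.Theory.

Local Open Scope ring_scope.

(* A matroid is given by its family of independent sets, and its ground set is
   the whole finite type E.  The operations below (bases, circuits, duals,
   minors, isomorphism) depend only on that family, so they are defined on
   arbitrary families; they have their usual meaning on matroids. *)
Record matroid (E : finType) := Matroid {
  indep :> {set {set E}};
  _ : set0 \in indep;
  _ : forall A B : {set E}, A \subset B -> B \in indep -> A \in indep;
  _ : forall A B : {set E}, A \in indep -> B \in indep -> (#|A| < #|B|)%N ->
        exists2 e, e \in B :\: A & e |: A \in indep
}.

Section Matroids.

Context {E : finType}.
Implicit Types (I : {set {set E}}) (A B C D X : {set E}).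

Definition basis_of I X B : bool :=
  maxset (fun A => (A \in I) && (A \subset X)) B.

Definition circuit I C : bool := minset (fun A => A \notin I) C.

(* [partition set0 set0] holds, so the empty set is a cycle. *)
Definition is_cycle I C : Prop :=
  exists2 P : {set {set E}}, partition P C & forall X, X \in P -> circuit I X.

Definition matroid_dual I : {set {set E}} :=
  [set A : {set E} | [exists B, basis_of I [set: E] B && [disjoint A & B]]].

(* Contraction of C followed by deletion of D, for disjoint C and D. *)
Definition matroid_minor I C D : {set {set {e : E | e \notin C :|: D}}} :=
  [set A : {set {e : E | e \notin C :|: D}} |
    [exists B, basis_of I C B && (val @: A :|: B \in I)]].

Definition vector_family (F : fieldType) (r : nat) (v : E -> 'cV[F]_r) :
    {set {set E}} :=
  [set A : {set E} | free [seq v e | e <- enum A]].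

Definition binary I : Prop :=
  exists (r : nat) (v : E -> 'cV['F_2]_r), I = vector_family v.

End Matroids.

Definition matroid_iso (E T : finType) (I : {set {set E}}) (J : {set {set T}}) :
    Prop :=
  exists2 f : E -> T, bijective f & forall A, (A \in I) = (f @: A \in J).

Definition has_minor (E T : finType) (I : {set {set E}}) (J : {set {set T}}) :
    Prop :=
  exists C D : {set E}, [disjoint C & D] /\ matroid_iso (matroid_minor I C D) J.

(* The points of the Fano plane are the nonzero vectors of GF(2)^3. *)
Definition fano_point : finType := {x : 'cV['F_2]_3 | x != 0}.

Definition F7 : {set {set fano_point}} := vector_family (fun e => val e).

Definition R10_column : finType :=
  {x : 'cV['F_2]_5 | #|[set i : 'I_5 | x i 0 == 1]| == 3%N}.

Definition R10 : {set {set R10_column}} := vector_family (fun e => val e).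

Definition Kedge (n : nat) : finType := {e : {set 'I_n} | #|e| == 2%N}.

Definition Kadj (n : nat) (A : {set Kedge n}) : rel 'I_n :=
  fun x y => [set x; y] \in val @: A.

(* A forest is an edge set without a graph cycle, i.e. without a cyclic
   sequence of at least three distinct, consecutively adjacent vertices. *)
Definition forest (n : nat) (A : {set Kedge n}) : Prop :=
  forall s : seq 'I_n, ucycle (Kadj A) s -> (size s < 3)%N.

Definition MK (n : nat) : {set {set Kedge n}} :=
  [set A : {set Kedge n} | `[< forest A >]].

From mathcomp Require Import finmap classical_sets functions cardinality reals.

Local Open Scope classical_set_scope.

Section ConvexGeometry.

Context {R : realType}.

Section Hulls.

Context {V : vectType R}.
Implicit Types (S P F : set V).

Definition affine_hull S : set V :=
  [set y | exists (n : nat) (x : 'I_n -> V) (a : 'I_n -> R),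
     [/\ forall i, S (x i), \sum_i a i = 1 & y = \sum_i a i *: x i]].

Definition convex_hull S : set V :=
  [set y | exists (n : nat) (x : 'I_n -> V) (a : 'I_n -> R),
     [/\ forall i, S (x i), forall i, 0 <= a i, \sum_i a i = 1
       & y = \sum_i a i *: x i]].

(* The affine hull of S is a translate of a k-dimensional linear subspace.
   The empty set has no dimension in this sense. *)
Definition has_dim S (k : nat) : Prop :=
  exists (x0 : V) (U : {vspace V}),
    affine_hull S = [set x0 + u | u in [set u | u \in U]] /\ (\dim U)%VS = k.

(* Both P itself and the empty set may arise as faces. *)
Definition face P F : Prop :=
  exists (c : {scalar V}) (delta : R),
    (forall x, P x -> c x <= delta) /\ F = P `&` [set x | c x = delta].

Definition vertex P (v : V) : Prop := face P [set v].

(* By has_dim, facets are nonempty; in particular a point has no facets. *)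
Definition facet P F : Prop :=
  face P F /\ exists2 k : nat, has_dim F k & has_dim P k.+1.

Definition num_vertices P : nat := #|` fset_set [set v | vertex P v]|.

Definition num_facets P : nat := #|` fset_set [set F | facet P F]|.

Definition two_level P : Prop :=
  forall F, facet P F ->
    exists t : V, forall v, vertex P v -> ~ F v ->
      [set t + y | y in affine_hull F] v.

End Hulls.

Definition affinely_isomorphic (V W : vectType R) (P : set V) (Q : set W) :
    Prop :=
  exists (f : {linear V -> W}) (b : W), set_bij P Q (fun x => f x + b).

(* R^I is {ffun I -> R^o}, R^o being R as a vector space over itself. *)
Definition cube (d : nat) : set {ffun 'I_d -> R^o} :=
  [set x : {ffun 'I_d -> R^o} | forall i, -1 <= (x i : R) <= 1].

Definition polar (I : finType) (P : set {ffun I -> R^o}) :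
    set {ffun I -> R^o} :=
  [set y | forall x, P x -> \sum_i (x i * y i : R) <= 1].

Definition cross_polytope (d : nat) : set {ffun 'I_d -> R^o} := polar (@cube d).

Definition char_vector (E : finType) (C : {set E}) : {ffun E -> R^o} :=
  [ffun e => (e \in C)%:R].

Definition cycle_polytope (E : finType) (M : {set {set E}}) :
    set {ffun E -> R^o} :=
  convex_hull [set char_vector C | C in [set C | is_cycle M C]].

End ConvexGeometry.

Arguments cube R d : clear implicits.
Arguments cross_polytope R d : clear implicits.
Arguments cycle_polytope R {E} M.

(* Main.v *)
From HB Require Import structures.
Require Import Defs.
From mathcomp Require Import all_boot all_order all_algebra.
From mathcomp Require Import boolp reals.
From mathcomp Require Import ring lra zify.

(** Let K be the set of cycles of the binary matroid, a vector space over GF(2)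
under symmetric difference. Every element e defines a sign character of K,
sending a cycle A to -1 if e is in A and to 1 otherwise. Let S contain one
element for each nontrivial character obtained in this way, and let n be its
size. Distinct characters are orthogonal, so the polytope has dimension n, its
vertices correspond to K, and its affine functions are the functions on K in
the span of 1 and of the characters from S. Two-levelness turns each facet into
a 0/1 function f of this span, the indicator of the vertices off the facet, and
the facets are exactly the f such that the functions of the span vanishing
wherever f does are the multiples of f ([num_facets_family]).

The bound comes from restricting such functions to the hyperplane
H = [off K x] for some x in S. On H some elements of S become equal in pairs;
let P contain one element of each of these p pairs, and let U be the set of the
u elements other than x that stay alone, so that n = 1 + 2p + u. Once its
restriction to H is known, a function of the span varies, on the other coset
H' of H, in a coset of the span W of 1 and P. There are at most 2^(p+1)
functions with values 0 and 1 in W, but only 2^p in any other coset of W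
([card_boolspan_coset]). Let b(K, S) be the number of 0/1 functions of the span
and a(K, S) the number of subsets of S cut out by K. Then
  b(K, S) <= 2^p (b(H, P + U) + b(H, P)),
  a(K, S) <= 2 a(H, P + U) <= 2^(u+1) a(H, P),
and b(K, S) a(K, S) <= (n+1) 2^(n+1) follows by induction
([boolspan_traces_bound]). For facets the estimate improves: a facet function
that lies in W on H vanishes on H or on H', whence there are at most
2^p b(H, P + U) of them ([card_facet_split]), and their number multiplied by
a(K, S) is at most (n-p) 2^(n+1) ([facet_traces_bound]).

Equality therefore forces p = 0 for every x in S, that is, no element of S is
the sum of two others, together with equality in the bound for b on every
hyperplane H. Then either K cuts out all the subsets of S, and the polytope is
a cube, or S is closed under sums of three elements ([facet_traces_tight]). In
the latter case S is a hyperplane complement in the group of characters,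
translation by a cycle that contains S is an antipodal symmetry, and the
polytope is a cross-polytope ([isomorphic_cross]). Conversely, an isomorphism
with a cube or a cross-polytope shows that there are at least as many vertices
and facets as equality requires ([cube_vertices], [cube_facets] and
[cross_vertices_facets]). *)

Set Implicit Arguments.
Unset Strict Implicit.
Unset Printing Implicit Defensive.
Import Order.TTheory GRing.Theory Num.Theory.
Local Open Scope ring_scope.

(** * Zero-one functions in affine spaces of functions *)

Lemma natr_bool_inj (R : numDomainType) (b1 b2 : bool) :
  b1%:R = b2%:R :> R -> b1 = b2.
Proof. by move/eqP; rewrite eqr_nat; case: b1; case: b2. Qed.

Section AffineSpan.
Variables (R : realFieldType) (T I : finType) (w : I -> T -> R).
Implicit Types (D X Y Z : {set T}) (S : {set I}) (f g : T -> R).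

Definition indicator Z (x : T) : R := (x \in Z)%:R.

(** Only the values on [D] matter: this is the span of 1 and the [w i] in the
    space of functions on [D]. *)
Definition affspan D S f : Prop :=
  exists (a0 : R) (a : I -> R),
    forall x, x \in D -> f x = a0 + \sum_(i in S) a i * w i x.

Definition boolspan D S : {set {set T}} :=
  [set Z : {set T} | (Z \subset D) && `[< affspan D S (indicator Z) >]].

Lemma boolspanP D S Z :
  reflect (Z \subset D /\ affspan D S (indicator Z)) (Z \in boolspan D S).
Proof.
rewrite inE; apply: (iffP andP) => -[sZD aZ]; split => //; exact/asboolP.
Qed.

Lemma affspan_ext D S f g :
  (forall x, x \in D -> f x = g x) -> affspan D S f -> affspan D S g.
Proof. by move=> fg [a0 [a fE]]; exists a0, a => x xD; rewrite -fg // fE. Qed.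

Lemma affspan_const D S c : affspan D S (fun=> c).
Proof.
by exists c, (fun=> 0) => x _; rewrite big1 ?addr0// => i _; rewrite mul0r.
Qed.

Lemma affspan_gen D S i : i \in S -> affspan D S (w i).
Proof.
move=> iS; exists 0, (fun j => (j == i)%:R) => x _.
rewrite (bigD1 i)//= eqxx mul1r add0r big1 ?addr0// => j /andP[_ /negPf->].
by rewrite mul0r.
Qed.

Lemma affspan_comb D S c f g :
  affspan D S f -> affspan D S g -> affspan D S (fun x => c * f x + g x).
Proof.
move=> [a0 [a fE]] [b0 [b gE]]; exists (c * a0 + b0), (fun i => c * a i + b i).
move=> x xD; rewrite fE// gE// mulrDr addrACA; congr (_ + _).
by rewrite mulr_sumr -big_split/=; apply: eq_bigr => i _; rewrite mulrDl mulrA.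
Qed.

Lemma affspanZ D S c f : affspan D S f -> affspan D S (fun x => c * f x).
Proof.
move=> sf; apply: affspan_ext (affspan_comb c sf (affspan_const D S 0)) => x _.
by rewrite addr0.
Qed.

Lemma affspanD D S f g :
  affspan D S f -> affspan D S g -> affspan D S (fun x => f x + g x).
Proof.
move=> sf sg; apply: affspan_ext (affspan_comb 1 sf sg) => x _.
by rewrite mul1r.
Qed.

Lemma affspanB D S f g :
  affspan D S f -> affspan D S g -> affspan D S (fun x => f x - g x).
Proof.
move=> sf sg; apply: affspan_ext (affspan_comb (-1) sg sf) => x _.
by rewrite mulN1r addrC.
Qed.

Lemma affspan_sum D S (J : Type) (r : seq J) (p : pred J) (F : J -> T -> R) :
  (forall j, p j -> affspan D S (F j)) ->
  affspan D S (fun x => \sum_(j <- r | p j) F j x).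
Proof.
move=> sF; elim: r => [|j r IHr].
  by apply: affspan_ext (affspan_const D S 0) => x _; rewrite big_nil.
case: (boolP (p j)) => pj; last first.
  by apply: affspan_ext IHr => x _; rewrite big_cons (negPf pj).
apply: affspan_ext (affspanD (sF j pj) IHr) => x _.
by rewrite big_cons pj.
Qed.

Lemma affspan_mono D S S' f :
  S' \subset S -> affspan D S' f -> affspan D S f.
Proof.
move=> /subsetP sS [a0 [a fE]].
apply: (@affspan_ext _ _ (fun x => a0 + \sum_(i in S') a i * w i x)).
  by move=> x xD; rewrite fE.
apply: affspanD; first exact: affspan_const.
by apply: affspan_sum => i iS; apply/affspanZ/affspan_gen/sS.
Qed.

Definition dual_basis D S X (c : T -> T -> R) : Prop :=
  (forall x, x \in X -> affspan D S (c x)) /\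
  (forall x y, x \in X -> y \in X -> c x y = (x == y)%:R).

(** The identity matrix of size [#|X|] factors through dimension [1 + #|S|],
    where the additional dimension accounts for the constants. *)
Lemma card_dual_basis D S X c :
  X \subset D -> dual_basis D S X c -> (#|X| <= #|S|.+1)%N.
Proof.
move=> /subsetP sXD [sc cE].
have /choice[ab abE] : forall x, exists ab : R * (I -> R), x \in X ->
    forall y, y \in D -> c x y = ab.1 + \sum_(i in S) ab.2 i * w i y.
  move=> x; case: (boolP (x \in X)) => [/sc[a0 [a E]]|xX].
    by exists (a0, a).
  by exists (0, fun=> 0).
pose A : 'M[R]_(#|X|, 1 + #|S|) :=
  row_mx (\col_i (ab (enum_val i)).1)
         (\matrix_(i, j) (ab (enum_val i)).2 (enum_val j)).
pose B : 'M[R]_(1 + #|S|, #|X|) :=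
  col_mx (const_mx 1) (\matrix_(i, j) w (enum_val i) (enum_val j)).
have AB1 : A *m B = 1%:M.
  rewrite mul_row_col; apply/matrixP => i j; rewrite !mxE big_ord1 !mxE mulr1.
  have iX := enum_valP i; have jX := enum_valP j.
  have -> : (i == j) = (enum_val i == enum_val j) by rewrite (inj_eq enum_val_inj).
  rewrite -cE// abE ?sXD//; congr (_ + _).
  rewrite [RHS]big_enum_val; apply: eq_bigr => l _; by rewrite !mxE.
rewrite -[leqLHS](mxrank1 R) -AB1.
by apply: leq_trans (mulmx_max_rank _ _) _; rewrite add1n.
Qed.

(** Take [X] maximal among the sets with a dual basis. A function of the span
    vanishing on [X] but not at [y] would allow [y] to be added to [X]. *)
Lemma interpolation D S : exists (X : {set T}) (c : T -> T -> R),
  [/\ X \subset D, (#|X| <= #|S|.+1)%N,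
      forall x, x \in X -> affspan D S (c x) &
      forall f, affspan D S f ->
        forall y, y \in D -> f y = \sum_(x in X) f x * c x y].
Proof.
pose Q X := (X \subset D) && `[< exists c, dual_basis D S X c >].
have Q0 : Q set0.
  rewrite /Q sub0set; apply/asboolP; exists (fun _ _ => 0).
  by split=> [x|x y]; rewrite inE.
have [X /maxsetP[/andP[sXD /asboolP[c cP]] maxX]] := ex_maxset (ex_intro (fun A => is_true (Q A)) _ Q0).
exists X, c; split=> //; first exact: card_dual_basis cP.
  by move=> x /cP.1.
move=> f sf y yD; pose h z := f z - \sum_(x in X) f x * c x z.
have sh : affspan D S h.
  apply: affspanB => //; apply: affspan_sum => x xX; apply: affspanZ.
  exact: cP.1.
have hX x : x \in X -> h x = 0.
  move=> xX; rewrite /h (bigD1 x)//= cP.2// eqxx mulr1 big1 ?addr0 ?subrr//.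
  by move=> z /andP[zX /negPf zx]; rewrite cP.2// zx mulr0.
suff : h y = 0 by move/eqP; rewrite subr_eq0 => /eqP.
apply/eqP; apply: contraT => hy.
have yX : y \notin X by apply: contraNN hy => /hX ->.
suff : Q (y |: X).
  move=> /maxX/(_ (subsetUr _ _))XE.
  by move: yX; rewrite -XE setU11.
apply/andP; split; first by rewrite subUset sub1set yD.
apply/asboolP.
exists (fun x z => if x == y then h z / h y else c x z - c x y * (h z / h y)).
split=> [x|x z].
  rewrite !inE; case: eqVneq => [_ _|_ /= xX].
    apply: (@affspan_ext _ _ (fun z => (h y)^-1 * h z)); last exact: affspanZ.
    by move=> z _; rewrite mulrC.
  apply: affspanB; first exact: cP.1.
  apply: affspanZ; apply: (@affspan_ext _ _ (fun z => (h y)^-1 * h z)).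
    by move=> z _; rewrite mulrC.
  exact: affspanZ.
rewrite !inE; case: eqVneq => [->|xy] /=.
  move=> _; case: eqVneq => [->|zy /= zX]; first by rewrite divff// eqxx.
  by rewrite hX// mul0r.
move=> xX; case: eqVneq => [->|zy /= zX].
  by rewrite divff// mulr1 subrr (negPf xy).
by rewrite hX// mul0r mulr0 subr0 cP.2.
Qed.

(** The values at the interpolation points are 0 or 1 and determine the rest. *)
Lemma card_boolspan_leq D S : (#|boolspan D S| <= 2 ^ #|S|.+1)%N.
Proof.
have [X [c [sXD cX _ fE]]] := interpolation D S.
apply: (@leq_trans #|powerset X|); last by rewrite card_powerset leq_exp2l.
have inj : {in boolspan D S &, injective (fun Z => Z :&: X)}.
  move=> Z Z' /boolspanP[sZ aZ] /boolspanP[sZ' aZ'] ZZ'.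
  apply/setP => y; case: (boolP (y \in D)) => yD; last first.
    have out (W : {set T}) : W \subset D -> (y \in W) = false.
      by move=> /subsetP sW; apply: contraNF yD => /sW.
    by rewrite !out.
  have E : indicator Z y = indicator Z' y.
    rewrite fE// [RHS]fE//; apply: eq_bigr => x xX; congr (_ * _).
    by move/setP: ZZ' => /(_ x); rewrite !inE xX !andbT /indicator => ->.
  exact: natr_bool_inj E.
rewrite -(card_in_imset inj).
by apply/subset_leq_card/subsetP => _ /imsetP[Z _ ->]; rewrite inE subsetIr.
Qed.

End AffineSpan.

Lemma card_half (T : finType) (A G : {set T}) (phi : T -> T) :
  G \subset A -> {in A, forall x, phi x \in A} -> injective phi ->
  {in G, forall x, phi x \notin G} -> (2 * #|G| <= #|A|)%N.
Proof.
move=> /subsetP sGA phiA phiI phiG.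
have dG : [disjoint G & phi @: G].
  rewrite disjoint_sym disjoints_subset; apply/subsetP => _ /imsetP[x xG ->].
  by rewrite inE phiG.
rewrite mul2n -addnn -{2}(card_imset (mem G) phiI).
have := leq_card_setU G (phi @: G).
move=> _; have -> : (#|G| + #|phi @: G| = #|G :|: phi @: G|)%N.
  by rewrite cardsU (disjoint_setI0 dG) cards0 subn0.
apply/subset_leq_card/subsetP => x; rewrite inE => /orP[/sGA//|].
by move=> /imsetP[y /sGA yA ->]; exact: phiA.
Qed.

(** Some injection takes each good subset to a bad one. If a coefficient [c x] is
    not 0, 1 or -1, adding or removing [x] is such an injection, since it changes
    the sum by [c x]. Otherwise all the sums are integers and complementation
    works: the two sums add up to 1, so that if [Y] and its complement were both
    good, [c0] would be 1/2 or -1/2 and the sum over [Y] would be 1/2. *)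
Lemma card_subset_sums (R : realFieldType) (T : finType) (X : {set T})
    (c : T -> R) (c0 : R) :
  \sum_(x in X) c x = 1 -> c0 != 0 ->
  (2 * #|[set Y in powerset X |
       (\sum_(x in Y) c x + c0 == 0)%R || (\sum_(x in Y) c x + c0 == 1)%R]|
     <= 2 ^ #|X|)%N.
Proof.
move=> c1 c0N; rewrite -card_powerset.
set G := [set Y in _ | _].
have sG : G \subset powerset X by apply/subsetP => Y; rewrite inE => /andP[].
have [/existsP[x /andP[xX cx]]|] :=
  boolP [exists x, (x \in X) && [&& c x != 0, c x != 1 & c x != -1]].
  pose phi (Y : {set T}) := [set y | (y \in Y) (+) (y == x)].
  have phiK : involutive phi.
    by move=> Y; apply/setP => y; rewrite !inE -addbA addbb addbF.
  apply: (@card_half _ _ _ phi) => //; last 1 first.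
  - have key (Y : {set T}) : x \notin Y ->
        \sum_(y in phi Y) c y = c x + \sum_(y in Y) c y.
      move=> xY; rewrite (bigD1 x)/=; last by rewrite inE eqxx (negPf xY).
      congr (_ + _); apply: eq_bigl => y; rewrite inE.
      by case: eqVneq => [->|_]; rewrite ?(negPf xY)//= andbT addbF.
    have bad (Y : {set T}) : x \notin Y -> Y \in G -> phi Y \notin G.
      move=> xY; rewrite !inE key// => /andP[_ Y01]; apply/negP => /andP[_].
      move: Y01; set s := \sum_(_ in Y) _ => Y01 Y01'.
      by case/and3P: cx => /eqP + /eqP + /eqP; move: Y01 Y01' =>
        /orP[]/eqP ? /orP[]/eqP ? *; lra.
    move=> Y YG; case: (boolP (x \in Y)) => xY; last exact: bad.
    apply/negP => pG; suff /bad/(_ pG) : x \notin phi Y by rewrite phiK YG.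
    by rewrite inE eqxx xY.
  - move=> Y; rewrite !inE => /subsetP sY; apply/subsetP => y; rewrite inE.
    by case: eqVneq => [->//|_]; rewrite addbF => /sY.
  - exact: (inv_inj phiK).
rewrite negb_exists => /forallP c01.
pose z x : int := if c x == 1 then 1 else if c x == -1 then -1 else 0.
have cz x : x \in X -> c x = (z x)%:~R.
  move=> xX; have := c01 x; rewrite xX /= /z.
  case: (eqVneq (c x) 1) => [->//|_]; case: (eqVneq (c x) (-1)) => [->|_].
    by rewrite mulrN1z.
  by rewrite !andbT negbK => /eqP->.
have compl (Y : {set T}) : Y \subset X ->
    \sum_(y in X :\: Y) c y = 1 - \sum_(y in Y) c y.
  move=> sYX; rewrite -c1 [in RHS](big_setID Y)/= (setIidPr sYX); lra.
apply: (@card_half _ _ _ (fun Y : {set T} => [set y | (y \in Y) (+) (y \in X)])) => //.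
- move=> Y; rewrite !inE => /subsetP sY; apply/subsetP => y; rewrite inE.
  by case: (boolP (y \in Y)) => // /sY ->.
- move=> Y Y' /setP YY'; apply/setP => y; move: (YY' y); rewrite !inE.
  exact: addIb.
move=> Y YG; have sYX : Y \subset X by move/(subsetP sG): YG; rewrite inE.
have -> : [set y | (y \in Y) (+) (y \in X)] = X :\: Y.
  apply/setP => y; rewrite !inE; case: (boolP (y \in Y)) => yY //=.
  by rewrite (subsetP sYX).
apply/negP; move: YG; rewrite !inE sYX subsetDl compl//=.
have [m ->] : exists m : int, \sum_(y in Y) c y = m%:~R.
  exists (\sum_(y in Y) z y); rewrite rmorph_sum/=.
  by apply: eq_bigr => y yY; rewrite cz// (subsetP sYX).
have half : m%:~R * 2 <> 1 :> R.
  move=> m1; have : (m * 2)%:~R = 1%:~R :> R by rewrite intrM.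
  move/eqP; rewrite eqr_int => /eqP; lia.
move/eqP: c0N => c0N /orP[]/eqP E1 /orP[]/eqP E2; first [lra | apply: half; lra].
Qed.

Section AffineFiber.
Variables (R : realFieldType) (T I : finType) (w : I -> T -> R).
Implicit Types (D X Y Z : {set T}) (S : {set I}).

(** This saves a factor 2 over [card_boolspan_leq]. The values at the
    interpolation points parametrize the coset. As the constants are in the span,
    the value at another point [y] is an affine combination of these, plus a
    number [c0 y]; it cannot vanish for all [y] because the coset is not the span
    itself, and [card_subset_sums] applies at a [y] where it does not. *)
Lemma card_boolspan_coset D S Z0 : Z0 \subset D -> Z0 \notin boolspan w D S ->
  (#|[set Z : {set T} | (Z \subset D) &&
       `[< affspan w D S (fun x => indicator R Z x - indicator R Z0 x)%R >]]| <= 2 ^ #|S|)%N.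
Proof.
move=> sZ0 nZ0; set G := [set Z | _].
have [X [c [sXD cX sc fE]]] := interpolation w D S.
pose c0 y := indicator R Z0 y - \sum_(x in X) indicator R Z0 x * c x y.
have [y yD c0y] : exists2 y, y \in D & c0 y != 0.
  apply/exists_inP; apply: contraT; rewrite negb_exists_in => /forall_inP c00.
  case/negP: nZ0; apply/boolspanP; split=> //.
  apply: (@affspan_ext _ _ _ _ _ _ (fun y => \sum_(x in X) indicator R Z0 x * c x y)).
    by move=> z /c00; rewrite negbK subr_eq0 => /eqP.
  by apply: affspan_sum => x xX; apply: affspanZ; exact: sc.
have c1 : \sum_(x in X) c x y = 1.
  rewrite [RHS](fE (fun=> 1) (affspan_const _ _ _ _) y yD).
  by apply: eq_bigr => x _; rewrite mul1r.
have GP Z : Z \in G -> forall z, z \in D ->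
    indicator R Z z = \sum_(x in Z :&: X) c x z + c0 z.
  rewrite inE => /andP[sZ /asboolP aZ] z zD.
  have := fE _ aZ z zD; rewrite /c0.
  under eq_bigr do rewrite mulrBl.
  rewrite sumrB => E; have -> : \sum_(x in Z :&: X) c x z =
      \sum_(x in X) indicator R Z x * c x z by
    rewrite big_mkcond [RHS]big_mkcond; apply: eq_bigr => x _; rewrite inE /indicator;
    case: (x \in Z); case: (x \in X); rewrite /= ?mul1r ?mul0r.
  lra.
have := card_subset_sums c1 c0y; set G' := [set Y in _ | _] => leG'.
have leGG' : (#|G| <= #|G'|)%N.
  have inj : {in G &, injective (fun Z => Z :&: X)}.
    move=> Z Z' ZG Z'G ZZ'; apply/setP => z.
    have := ZG; have := Z'G; rewrite !inE => /andP[sZ' _] /andP[sZ _].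
    case: (boolP (z \in D)) => zD; last first.
      have out (W : {set T}) : W \subset D -> (z \in W) = false.
        by move=> /subsetP sW; apply: contraNF zD => /sW.
      by rewrite !out.
    have E : indicator R Z z = indicator R Z' z by rewrite !GP// ZZ'.
    exact: natr_bool_inj E.
  rewrite -(card_in_imset inj).
  apply/subset_leq_card/subsetP => _ /imsetP[Z /GP ZP ->].
  rewrite !inE subsetIr /= -(ZP y yD) /indicator.
  by case: (y \in Z); rewrite eqxx ?orbT.
have : (2 * #|G| <= 2 * 2 ^ #|S|)%N.
  rewrite -expnS; apply: leq_trans (leq_mul (leqnn 2) leGG') _.
  by apply: leq_trans leG' _; rewrite leq_exp2l.
by rewrite leq_pmul2l.
Qed.

End AffineFiber.

(** * Sign characters of a binary vector space *)

Section SymmetricDifference.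
Variable E : finType.
Implicit Types (A B C : {set E}) (K : {set {set E}}) (S : {set E}).

Definition symdiff A B := [set e | (e \in A) (+) (e \in B)].

Lemma in_symdiff A B e : (e \in symdiff A B) = (e \in A) (+) (e \in B).
Proof. by rewrite inE. Qed.

Lemma symdiffKr B : involutive (symdiff^~ B).
Proof. by move=> A; apply/setP => e; rewrite !inE -addbA addbb addbF. Qed.

Lemma symdiff_eqr A B C : (symdiff A B == C) = (A == symdiff B C).
Proof.
apply/eqP/eqP => [<-|->]; apply/setP => e; rewrite !in_symdiff.
  by case: (e \in A); case: (e \in B).
by case: (e \in B); case: (e \in C).
Qed.

Lemma symdiff0 A : symdiff A set0 = A.
Proof. by apply/setP => e; rewrite in_symdiff inE addbF. Qed.

Definition symdiff_closed K : Prop :=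
  set0 \in K /\ {in K &, forall A B, symdiff A B \in K}.

Lemma symdiff_closedl K A B :
  symdiff_closed K -> B \in K -> (symdiff A B \in K) = (A \in K).
Proof.
move=> [_ KD] BK; apply/idP/idP => AK; last exact: KD.
by rewrite -(symdiffKr B A); apply: KD.
Qed.

(** For a vector space [K], the kernel of the linear form attached to [x], and
    the other coset of this kernel. *)
Definition off K x := [set A in K | x \notin A].
Definition on K x := [set A in K | x \in A].

Lemma on_off_subset K x : (on K x \subset K) * (off K x \subset K).
Proof. by split; apply/subsetP => A; rewrite inE => /andP[]. Qed.

Lemma symdiff_closed_off K x : symdiff_closed K -> symdiff_closed (off K x).
Proof.
move=> [K0 KD]; split=> [|A B]; first by rewrite !inE K0.
by rewrite !inE => /andP[AK /negPf->] /andP[BK /negPf->]; rewrite KD.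
Qed.

(** The characters of [K] attached to the elements of [S] are nontrivial and
    pairwise distinct. *)
Definition reduced K S : Prop :=
  (forall e, e \in S -> exists2 A, A \in K & e \in A) /\
  (forall e e', e \in S -> e' \in S ->
     (forall A, A \in K -> (e \in A) = (e' \in A)) -> e = e').

Lemma reduced_subset K S S' : S' \subset S -> reduced K S -> reduced K S'.
Proof.
by move=> /subsetP sS [r1 r2]; split=> [e /sS /r1//|e e' /sS eS /sS e'S]; apply: r2.
Qed.

Definition traces K S := [set A :&: S | A in K].

(** A linear form vanishing on the kernel of another one is a multiple of it,
    and the only scalars are 0 and 1. *)
Lemma additive_off K x (phi : {set E} -> bool) : symdiff_closed K ->
  {in K &, forall A B, phi (symdiff A B) = phi A (+) phi B} ->
  {in off K x, forall A, phi A = false} ->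
  {in K, forall A, phi A = false} \/ {in K, forall A, phi A = (x \in A)}.
Proof.
move=> [_ KD] phiD phi0.
have [/exists_inP[B BK phiB]|] := boolP [exists B in K, phi B]; last first.
  by rewrite negb_exists_in => /forall_inP nphi; left => A /nphi/negPf.
have xB : x \in B.
  by apply: contraTT phiB => xB; rewrite phi0// inE BK.
right=> A AK; case: (boolP (x \in A)) => xA; last by rewrite phi0// inE AK.
have : phi (symdiff A B) = false by rewrite phi0// !inE KD// xA xB.
by rewrite phiD// phiB addbT => /negbFE.
Qed.

End SymmetricDifference.

Section Characters.
Variables (R : realFieldType) (E : finType).
Implicit Types (A B : {set E}) (K : {set {set E}}) (S P U : {set E}).

Definition parity_char (e : E) A : R := (-1) ^+ (e \in A).

Lemma sgn_symdiff e A B : parity_char e (symdiff A B) = parity_char e A * parity_char e B.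
Proof. by rewrite /parity_char in_symdiff signr_addb. Qed.

Lemma sgn_sqr e A : parity_char e A * parity_char e A = 1.
Proof. by rewrite /parity_char -signr_addb addbb. Qed.

Lemma sum_odd0 K B (f : {set E} -> R) : symdiff_closed K -> B \in K ->
  (forall A, f (symdiff A B) = - f A) -> \sum_(A in K) f A = 0.
Proof.
move=> KD BK fN; set s := \sum_(_ in _) _; suff : s = - s by lra.
rewrite {1}/s (reindex_inj (inv_inj (symdiffKr B)))/= -sumrN.
by apply: eq_big => A; rewrite ?symdiff_closedl// => _; rewrite fN.
Qed.

Lemma sgn_orthogonal K S e e' : symdiff_closed K -> reduced K S ->
  e \in S -> e' \in S ->
  \sum_(A in K) parity_char e A * parity_char e' A = (e == e')%:R * #|K|%:R.
Proof.
move=> KD [_ r2] eS e'S; case: eqVneq => [<-|ee'].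
  by under eq_bigr do rewrite sgn_sqr; rewrite sumr_const mul1r.
rewrite mul0r.
have [/forall_inP eE|] := boolP [forall A in K, (e \in A) == (e' \in A)].
  by case/eqP: ee'; apply: r2 => // A /eE/eqP.
rewrite negb_forall_in => /exists_inP[B BK eB].
apply: (@sum_odd0 _ B) => // A; rewrite !sgn_symdiff mulrACA.
rewrite [X in _ * X](_ : _ = -1) ?mulrN1// /parity_char -signr_addb.
by move: eB; case: (e \in B); case: (e' \in B).
Qed.

Lemma sum_sgn K S e : symdiff_closed K -> reduced K S -> e \in S ->
  \sum_(A in K) parity_char e A = 0.
Proof.
move=> KD [r1 _] /r1[B BK eB]; apply: (@sum_odd0 _ B) => // A.
by rewrite sgn_symdiff {2}/parity_char eB mulrN1.
Qed.

Lemma card_symdiff_closed K : symdiff_closed K -> #|K|%:R != 0 :> R.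
Proof.
by move=> [K0 _]; rewrite pnatr_eq0 -lt0n; apply/card_gt0P; exists set0.
Qed.

Lemma sgn_independent K S (a0 : R) (a : E -> R) :
  symdiff_closed K -> reduced K S ->
  (forall A, A \in K -> a0 + \sum_(e in S) a e * parity_char e A = 0) ->
  forall e, e \in S -> a e = 0.
Proof.
move=> KD Kr aE e eS.
have : \sum_(A in K) (a0 + \sum_(e' in S) a e' * parity_char e' A) * parity_char e A = 0.
  by apply: big1 => A /aE ->; rewrite mul0r.
under eq_bigr do rewrite mulrDl mulr_suml.
rewrite big_split/= -mulr_sumr (sum_sgn KD Kr eS) mulr0 add0r exchange_big/=.
under eq_bigr => e' e'S.
  under eq_bigr do rewrite -mulrA.
  rewrite -mulr_sumr (sgn_orthogonal KD Kr e'S eS).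
  over.
rewrite (bigD1 e)//= eqxx mul1r big1 ?addr0; last first.
  by move=> e' /andP[_ /negPf->]; rewrite mul0r mulr0.
by move/eqP; rewrite mulf_eq0 (negPf (card_symdiff_closed KD)) orbF => /eqP.
Qed.

(** Translation by an element of [on K x] maps [on K x] to [off K x] and changes
    each character by a sign only. *)
Lemma sgn_independent_on K S x (a0 : R) (a : E -> R) :
  symdiff_closed K -> reduced (off K x) S -> (exists2 B, B \in K & x \in B) ->
  (forall A, A \in on K x -> a0 + \sum_(e in S) a e * parity_char e A = 0) ->
  forall e, e \in S -> a e = 0.
Proof.
move=> KD Kr [B BK xB] aE e eS.
suff /eqP : a e * parity_char e B = 0 by rewrite mulf_eq0 signr_eq0 orbF => /eqP.
apply: (@sgn_independent (off K x) S a0 (fun e => a e * parity_char e B)) => //.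
  exact: symdiff_closed_off.
move=> A; rewrite inE => /andP[AK xA]; rewrite -[RHS](aE (symdiff A B)).
  congr (_ + _); apply: eq_bigr => e' _; rewrite sgn_symdiff; ring.
by rewrite inE symdiff_closedl// AK inE xB (negPf xA).
Qed.

(** In the group of characters of [K], [e'] is the sum of [e] and [x]. For
    distinct elements of a reduced set, this means that they agree on
    [off K x]. *)
Definition partner K x e e' : bool :=
  [forall A in K, (e' \in A) == (e \in A) (+) (x \in A)].

Lemma partnerP K x e e' :
  reflect {in K, forall A, (e' \in A) = (e \in A) (+) (x \in A)}
          (partner K x e e').
Proof.
by apply: (iffP forall_inP) => h A /h; [move/eqP|move->].
Qed.

Lemma partner_sym K x e e' : partner K x e e' -> partner K x e' e.
Proof.
move/partnerP => h; apply/partnerP => A AK.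
by rewrite h// -addbA addbb addbF.
Qed.

(** On [off K x] each [e] in [P] becomes equal to [pi e], and the elements of [U]
    are those which become equal to no other element of [S]. *)
Record splits K S x (P U : {set E}) (pi : E -> E) : Prop := Splits {
  splits_x : x \in S;
  splits_S : S = x |: (P :|: (pi @: P :|: U));
  splits_xN : x \notin P :|: (pi @: P :|: U);
  splits_PN : [disjoint P & pi @: P :|: U];
  splits_UN : [disjoint pi @: P & U];
  splits_inj : {in P &, injective pi};
  splits_pi : forall e, e \in P -> partner K x e (pi e);
  splits_U : forall e e', e \in U -> e' \in S -> ~~ partner K x e e' }.

Lemma partner_uniq K S x e e1 e2 : reduced K S -> e1 \in S -> e2 \in S ->
  partner K x e e1 -> partner K x e e2 -> e1 = e2.
Proof.
move=> [_ r2] e1S e2S /partnerP h1 /partnerP h2; apply: r2 => // A AK.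
by rewrite h1// h2.
Qed.

(** Partners come in pairs; [P] takes from each pair the element that is first
    in the enumeration of the ground set. *)
Lemma splits_exist K S x : reduced K S -> x \in S ->
  exists P U pi, splits K S x P U pi.
Proof.
move=> Kr xS; have [r1 r2] := Kr.
pose pi e := odflt e [pick e' in S | partner K x e e'].
pose pd e := [exists e' in S, partner K x e e'].
have piP e : pd e -> (pi e \in S) /\ partner K x e (pi e).
  move=> /exists_inP[e' e'S pe']; rewrite /pi; case: pickP => [e''/andP[]//|].
  by move/(_ e'); rewrite e'S pe'.
have pdx : ~~ pd x.
  apply/exists_inP => -[e' /r1[A AK e'A] /partnerP/(_ A AK)].
  by rewrite e'A addbb.
have pdpi e : e \in S -> pd e -> pd (pi e) /\ pi (pi e) = e.
  move=> eS pe; have [piS ppi] := piP _ pe.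
  have pp : pd (pi e) by apply/exists_inP; exists e => //; exact: partner_sym.
  split=> //; have [ppS pppi] := piP _ pp.
  by apply: (partner_uniq Kr ppS eS pppi); exact: partner_sym.
have piN e : e \in S -> pd e -> pi e != e.
  move=> eS /piP[_]; apply: contraPneq => -> /partnerP h.
  by have [A AK xA] := r1 _ xS; move: (h A AK); rewrite xA; case: (e \in A).
pose P := [set e in S | pd e && (enum_rank e < enum_rank (pi e))%N].
pose U := [set e in S :\ x | ~~ pd e].
have QE : pi @: P = [set e in S | pd e && (enum_rank (pi e) < enum_rank e)%N].
  apply/setP => e; apply/imsetP/idP => [[e' + ->]|].
    rewrite !inE => /and3P[e'S pe' lt].
    have [pS _] := piP _ pe'; have [pp ppE] := pdpi _ e'S pe'.
    by rewrite pS pp ppE.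
  rewrite inE => /and3P[eS pe lt]; have [pp ppE] := pdpi _ eS pe.
  have [pS _] := piP _ pe.
  by exists (pi e); rewrite ?inE ?ppE ?pS ?pp.
exists P, U, pi; split=> //.
- apply/setP => e; rewrite QE !inE.
  case: (eqVneq e x) => [->|ex] //=; case: (boolP (e \in S)) => //= eS.
  case: (boolP (pd e)) => //= pe; rewrite orbF.
  have := piN _ eS pe; rewrite -(inj_eq enum_rank_inj) -(inj_eq val_inj)/=.
  by case: ltngtP.
- by rewrite QE !inE eqxx (negPf pdx) !andbF.
- rewrite QE disjoints_subset; apply/subsetP => e; rewrite !inE.
  by case/and3P => -> -> lt /=; rewrite andbF orbF -leqNgt ltnW.
- rewrite QE disjoints_subset; apply/subsetP => e; rewrite !inE.
  by case/and3P => -> -> lt /=; rewrite andbF.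
- move=> e e'; rewrite !inE => /and3P[eS pe _] /and3P[e'S pe' _] E1.
  by rewrite -(pdpi _ eS pe).2 E1 (pdpi _ e'S pe').2.
- by move=> e; rewrite inE => /and3P[_ /piP[]].
- move=> e e'; rewrite !inE => /andP[_ /exists_inP pe] e'S.
  by apply/negP => pp; apply: pe; exists e'.
Qed.

Lemma sum_setU (A B : {set E}) (F : E -> R) : [disjoint A & B] ->
  \sum_(e in A :|: B) F e = \sum_(e in A) F e + \sum_(e in B) F e.
Proof.
by move=> dAB; rewrite -bigU//; apply: eq_bigl => e; rewrite inE.
Qed.

Section Split.
Variables (K : {set {set E}}) (S P U : {set E}) (x : E) (pi : E -> E).
Hypotheses (KD : symdiff_closed K) (Kr : reduced K S).
Hypothesis sp : splits K S x P U pi.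

Let H := off K x.
Let H' := on K x.

Lemma splits_sum (F : E -> R) :
  \sum_(e in S) F e = F x + \sum_(e in P) (F e + F (pi e)) + \sum_(e in U) F e.
Proof.
rewrite (splits_S sp) big_setU1 ?(splits_xN sp)//= sum_setU ?(splits_PN sp)//.
rewrite sum_setU ?(splits_UN sp)// big_imset/=; last exact: splits_inj sp.
by rewrite big_split/= !addrA.
Qed.

Lemma splits_card : #|S| = (1 + 2 * #|P| + #|U|)%N.
Proof.
have disj (A B : {set E}) : [disjoint A & B] -> #|A :|: B| = (#|A| + #|B|)%N.
  by move=> dAB; rewrite cardsU (disjoint_setI0 dAB) cards0 subn0.
rewrite (splits_S sp) cardsU1 (splits_xN sp) disj ?(splits_PN sp)//.
rewrite disj ?(splits_UN sp)// card_in_imset; last exact: splits_inj sp.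
lia.
Qed.

Lemma splits_sub : (P \subset S) * (U \subset S) * (pi @: P \subset S).
Proof.
rewrite (splits_S sp); split; [split|]; apply/subsetP => e.
- by move=> eP; rewrite !inE eP orbT.
- by move=> eU; rewrite !inE eU !orbT.
- by move=> eQ; rewrite !inE eQ !orbT.
Qed.

Lemma splits_PU : [disjoint P & U].
Proof.
have := splits_PN sp; rewrite !disjoints_subset => sub.
by apply: subset_trans sub _; rewrite setCS subsetUr.
Qed.

Lemma splits_xPU : (x \notin P) * (x \notin U).
Proof.
by have := splits_xN sp; rewrite !inE !negb_or => /and3P[-> _ ->].
Qed.

Lemma splits_xS : exists2 B, B \in K & x \in B.
Proof. exact: Kr.1 (splits_x sp). Qed.

Lemma sgn_partner e A : e \in P -> A \in K ->
  parity_char (pi e) A = parity_char e A * parity_char x A.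
Proof.
by move=> /(splits_pi sp)/partnerP pe AK; rewrite /parity_char pe// signr_addb.
Qed.

(** By [additive_off], two elements of [S] that agree on the kernel of [x] are
    equal or partners, and [P :|: U] contains no two partners. *)
Lemma reduced_off : reduced H (P :|: U).
Proof.
have [r1 r2] := Kr.
have PUS e : e \in P :|: U -> e \in S.
  by rewrite inE => /orP[]; apply/subsetP; rewrite splits_sub.
have PUx e : e \in P :|: U -> e <> x.
  by move=> + ex; rewrite ex inE; rewrite !(negPf splits_xPU.1) (negPf splits_xPU.2).
split=> [e ePU|e e' ePU e'PU ee'].
  apply/exists_inP; apply: contraT; rewrite negb_exists_in => /forall_inP e0.
  have [] := @additive_off E K x (fun A => e \in A) KD.
  - by move=> A B _ _; rewrite in_symdiff.
  - by move=> A /e0/negPf.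
  - by have [A AK eA] := r1 _ (PUS _ ePU) => /(_ _ AK); rewrite eA.
  - by move=> h; case: (PUx _ ePU); apply: r2 (PUS _ ePU) (splits_x sp) h.
have [] := @additive_off E K x (fun A => (e \in A) (+) (e' \in A)) KD.
- by move=> A B _ _; rewrite !in_symdiff addbACA.
- by move=> A /ee' ->; rewrite addbb.
- move=> h; apply: r2; [exact: PUS|exact: PUS|move=> A /h].
  by case: (e \in A); case: (e' \in A).
move=> h; have pee' : partner K x e e'.
  by apply/partnerP => A AK; rewrite -h// addbA addbb.
have eP : e \in P.
  move: ePU; rewrite inE => /orP[//|eU].
  by have := splits_U sp eU (PUS _ e'PU); rewrite pee'.
have e'P : e' \in P.
  move: e'PU; rewrite inE => /orP[//|eU].
  by have := splits_U sp eU (PUS _ ePU); rewrite partner_sym.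
have e'E : e' = pi e.
  apply: (partner_uniq Kr _ _ pee'); first exact: PUS.
    by apply: (subsetP splits_sub.2); exact: imset_f.
  exact: splits_pi sp _ eP.
have := splits_PN sp; rewrite disjoints_subset => /subsetP/(_ _ e'P).
by rewrite e'E !inE imset_f.
Qed.

Lemma reduced_offP : reduced H P.
Proof. apply: reduced_subset reduced_off; exact: subsetUl. Qed.

Section Restriction.
Variables (f : {set E} -> R) (a0 : R) (a : E -> R).
Hypothesis fE : forall A, A \in K -> f A = a0 + \sum_(e in S) a e * parity_char e A.

Lemma restrict_off A : A \in H ->
  f A = (a0 + a x) + \sum_(e in P) (a e + a (pi e)) * parity_char e A
                   + \sum_(e in U) a e * parity_char e A.
Proof.
rewrite inE => /andP[AK xA]; rewrite fE// splits_sum.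
rewrite {1}/parity_char (negPf xA) expr0 mulr1 !addrA; congr (_ + _ + _).
apply: eq_bigr => e eP; rewrite sgn_partner// [parity_char x A]/parity_char (negPf xA) expr0.
by rewrite mulr1 mulrDl.
Qed.

Lemma restrict_on A : A \in H' ->
  f A = (a0 - a x) + \sum_(e in P) (a e - a (pi e)) * parity_char e A
                   + \sum_(e in U) a e * parity_char e A.
Proof.
rewrite inE => /andP[AK xA]; rewrite fE// splits_sum.
rewrite {1}/parity_char xA expr1 mulrN1 !addrA; congr (_ + _ + _).
apply: eq_bigr => e eP; rewrite sgn_partner// [parity_char x A]/parity_char xA expr1.
by rewrite mulrN1 mulrN mulrBl.
Qed.

Lemma coef_off_on : affspan parity_char H P f -> forall e, e \in U -> a e = 0.
Proof.
move=> [b0 [b fb]] e eU.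
pose c e := if e \in U then a e else a e + a (pi e) - b e.
have <- : c e = a e by rewrite /c eU.
apply: (@sgn_independent H (P :|: U) (a0 + a x - b0) c).
- exact: symdiff_closed_off.
- exact: reduced_off.
- move=> A AH; rewrite sum_setU ?splits_PU//.
  have := restrict_off AH; rewrite fb// => E1.
  rewrite [X in _ + (X + _)](_ : _ =
    \sum_(e in P) (a e + a (pi e)) * parity_char e A - \sum_(e in P) b e * parity_char e A).
    rewrite [X in _ + (_ + X)](_ : _ = \sum_(e in U) a e * parity_char e A).
      lra.
    by apply: eq_bigr => e' e'U; rewrite /c e'U.
  rewrite -sumrB; apply: eq_bigr => e' e'P; rewrite /c.
  by rewrite (disjointFr splits_PU e'P) mulrBl.
- by rewrite inE eU orbT.
Qed.

Lemma coef_on_off : affspan parity_char H' P f -> forall e, e \in U -> a e = 0.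
Proof.
move=> [b0 [b fb]] e eU.
pose c e := if e \in U then a e else a e - a (pi e) - b e.
have <- : c e = a e by rewrite /c eU.
apply: (@sgn_independent_on K (P :|: U) x (a0 - a x - b0) c) => //.
- exact: reduced_off.
- exact: splits_xS.
- move=> A AH; rewrite sum_setU ?splits_PU//.
  have := restrict_on AH; rewrite fb// => E1.
  rewrite [X in _ + (X + _)](_ : _ =
    \sum_(e in P) (a e - a (pi e)) * parity_char e A - \sum_(e in P) b e * parity_char e A).
    rewrite [X in _ + (_ + X)](_ : _ = \sum_(e in U) a e * parity_char e A).
      lra.
    by apply: eq_bigr => e' e'U; rewrite /c e'U.
  rewrite -sumrB; apply: eq_bigr => e' e'P; rewrite /c.
  by rewrite (disjointFr splits_PU e'P) mulrBl.
- by rewrite inE eU orbT.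
Qed.

End Restriction.

(** On both cosets the condition says that the coefficients of [f] at [U] are 0,
    because partners have proportional characters on either coset. *)
Lemma affspan_off_on f :
  affspan parity_char K S f -> affspan parity_char H P f <-> affspan parity_char H' P f.
Proof.
move=> [a0 [a fE]]; split=> sf.
  exists (a0 - a x), (fun e => a e - a (pi e)) => A AH.
  rewrite (restrict_on fE)// [X in _ + X]big1 ?addr0// => e eU.
  by rewrite (coef_off_on fE)// mul0r.
exists (a0 + a x), (fun e => a e + a (pi e)) => A AH.
rewrite (restrict_off fE)// [X in _ + X]big1 ?addr0// => e eU.
by rewrite (coef_on_off fE)// mul0r.
Qed.

Lemma affspan_off f : affspan parity_char K S f -> affspan parity_char H (P :|: U) f.
Proof.
move=> [a0 [a fE]]; exists (a0 + a x).
exists (fun e => if e \in U then a e else a e + a (pi e)) => A AH.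
rewrite (restrict_off fE)// sum_setU ?splits_PU// addrA; congr (_ + _ + _).
  by apply: eq_bigr => e eP; rewrite (disjointFr splits_PU eP).
by apply: eq_bigr => e ->.
Qed.

(** The indicator of [off K x] is half of 1 plus the character of [x], and
    multiplication by that character exchanges partners. *)
Lemma affspan_off_only f : affspan parity_char H P f ->
  affspan parity_char K S (fun A => if x \in A then 0 else f A).
Proof.
move=> [b0 [b fE]].
apply: (@affspan_ext _ _ _ _ _ _ (fun A => 2^-1 * (b0 * parity_char x A + b0 +
    \sum_(e in P) (b e * parity_char e A + b e * parity_char (pi e) A)))); last first.
  apply: affspanZ; apply: affspanD.
    apply: affspan_comb; last exact: affspan_const.
    exact: affspan_gen (splits_x sp).
  apply: affspan_sum => e eP; apply: affspanD; apply/affspanZ/affspan_gen.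
    exact: (subsetP splits_sub.1.1).
  by apply: (subsetP splits_sub.2); exact: imset_f.
move=> A AK; case: ifP => xA.
  rewrite big1 ?addr0; first by rewrite /parity_char xA expr1; ring.
  by move=> e eP; rewrite sgn_partner// [parity_char x A]/parity_char xA expr1; ring.
rewrite fE; last by rewrite inE AK xA.
rewrite [X in _ + X](_ : _ = 2 * \sum_(e in P) b e * parity_char e A).
  by rewrite /parity_char xA expr0; field.
rewrite mulr_sumr; apply: eq_bigr => e eP.
by rewrite sgn_partner// [parity_char x A]/parity_char xA expr0; ring.
Qed.

End Split.
End Characters.

(** * Counting zero-one functions and facets *)

Section Counting.
Variables (R : realFieldType) (E : finType).
Implicit Types (X : {set {set {set E}}}).
Implicit Types (A B : {set E}) (K Y Z : {set {set E}}) (S P U : {set E}).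

Local Notation sgn := (@parity_char R E).
Local Notation ind := (@indicator R {set E}).

(** [Z] is the set of points off a face; the face is a facet when the affine
    functions that vanish on it form a line. *)
Definition supports_facet K S Z : Prop :=
  forall g, affspan sgn K S g -> (forall A, A \in K -> A \notin Z -> g A = 0) ->
  exists l, forall A, A \in K -> g A = l * ind Z A.

Definition facet_family K S : {set {set {set E}}} :=
  [set Z in boolspan sgn K S | (Z != set0) && `[< supports_facet K S Z >]].

Lemma indI Z Y A : A \in Y -> ind (Z :&: Y) A = ind Z A.
Proof. by move=> AY; rewrite /indicator inE AY andbT. Qed.

Lemma set0_boolspan K S : set0 \in boolspan sgn K S.
Proof.
apply/boolspanP; split; first exact: sub0set.
apply: affspan_ext (affspan_const _ _ _ 0) => A _.
by rewrite /indicator inE.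
Qed.

Lemma setT_boolspan K S : K \in boolspan sgn K S.
Proof.
apply/boolspanP; split => //.
by apply: affspan_ext (affspan_const _ _ _ 1) => A AK; rewrite /indicator AK.
Qed.

Lemma card_traces_set0 K : set0 \in K -> #|traces K set0| = 1%N.
Proof.
move=> K0; apply/eqP/cards1P; exists set0; apply/setP => Y; rewrite inE.
apply/imsetP/eqP => [[A _ ->]|->]; first by rewrite setI0.
by exists set0; rewrite // setI0.
Qed.

Lemma card_traces_leq K S : (#|traces K S| <= 2 ^ #|S|)%N.
Proof.
rewrite -card_powerset; apply/subset_leq_card/subsetP => _ /imsetP[A _ ->].
by rewrite inE subsetIr.
Qed.

Section Split.
Variables (K : {set {set E}}) (S P U : {set E}) (x : E) (pi : E -> E).
Hypotheses (KD : symdiff_closed K) (Kr : reduced K S).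
Hypothesis sp : splits K S x P U pi.

Local Notation H := (off K x).
Local Notation H' := (on K x).
Local Notation bK := (boolspan sgn K S).
Local Notation bH := (boolspan sgn H (P :|: U)).
Local Notation bP := (boolspan sgn H P).

Let in_on_off A : A \in K -> (A \in H) || (A \in H').
Proof. by rewrite !inE => ->; case: (x \in A). Qed.

Lemma boolspan_off Z : Z \in bK -> Z :&: H \in bH.
Proof.
move=> /boolspanP[sZ aZ]; apply/boolspanP; split; first exact: subsetIr.
apply: affspan_ext (affspan_off sp aZ) => A AH; by rewrite indI.
Qed.

Lemma boolspan_off_on Z : Z \in bK ->
  (Z :&: H \in bP) = (Z :&: H' \in boolspan sgn H' P).
Proof.
move=> /boolspanP[sZ aZ]; have [h1 h2] := affspan_off_on KD Kr sp aZ.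
apply/boolspanP/boolspanP => -[_ sZ'];
  (split; first exact: subsetIr).
- apply: affspan_ext (h1 _) => [A AH|]; first by rewrite indI.
  by apply: affspan_ext sZ' => A AH; rewrite indI.
- apply: affspan_ext (h2 _) => [A AH|]; first by rewrite indI.
  by apply: affspan_ext sZ' => A AH; rewrite indI.
Qed.

Lemma boolspanPU : bP \subset bH.
Proof.
apply/subsetP => Z /boolspanP[sZ aZ]; apply/boolspanP; split=> //.
exact: affspan_mono (subsetUl _ _) aZ.
Qed.

Lemma set_on_off Z Z' : Z \subset K -> Z' \subset K ->
  Z :&: H = Z' :&: H -> Z :&: H' = Z' :&: H' -> Z = Z'.
Proof.
move=> sZ sZ' /setP e1 /setP e2; apply/setP => A.
have [/in_on_off/orP[]|] := boolP (A \in K).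
- by move=> AH; move: (e1 A); rewrite 2!in_setI AH !andbT.
- by move=> AH; move: (e2 A); rewrite 2!in_setI AH !andbT.
have out (W : {set {set E}}) : W \subset K -> A \notin K -> (A \in W) = false.
  by move=> /subsetP sW; apply: contraNF => /sW.
by move=> AK; rewrite (out _ sZ AK) (out _ sZ' AK).
Qed.

Lemma bK_sub Z : Z \in bK -> Z \subset K.
Proof. by case/boolspanP. Qed.

Definition fiber (X : {set {set {set E}}}) Y := [set Z in X | Z :&: H == Y].

Lemma fiberI X Y : {in X &, forall Z Z', Z :&: H = Z' :&: H ->
   Z :&: H' = Z' :&: H' -> Z = Z'} ->
  #|fiber X Y| = #|[set Z :&: H' | Z in fiber X Y]|.
Proof.
move=> inj; rewrite card_in_imset// => Z Z'.
by rewrite !inE => /andP[ZX /eqP e] /andP[ZX' /eqP e'] /inj; apply; rewrite ?e.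
Qed.

Lemma card_fiber X Y : X \subset bK -> Y \in bP ->
  (#|fiber X Y| <= 2 ^ #|P|.+1)%N.
Proof.
move=> /subsetP sX YP; rewrite fiberI.
  apply: leq_trans (card_boolspan_leq sgn H' P).
  apply/subset_leq_card/subsetP => _ /imsetP[Z + ->].
  by rewrite inE => /andP[/sX ZK /eqP ZY]; rewrite -boolspan_off_on// ZY.
by move=> Z Z' /sX/bK_sub sZ /sX/bK_sub sZ'; apply: set_on_off.
Qed.

Lemma card_fiberN X Y : X \subset bK -> Y \notin bP ->
  (#|fiber X Y| <= 2 ^ #|P|)%N.
Proof.
move=> /subsetP sX YP; have [->|[Z0]] := set_0Vmem (fiber X Y).
  by rewrite cards0.
rewrite inE => /andP[/sX Z0K /eqP Z0Y].
rewrite fiberI; last first.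
  by move=> Z Z' /sX/bK_sub sZ /sX/bK_sub sZ'; apply: set_on_off.
have Z0N : Z0 :&: H' \notin boolspan sgn H' P.
  by rewrite -boolspan_off_on// Z0Y.
apply: leq_trans (card_boolspan_coset (subsetIr _ _) Z0N).
apply/subset_leq_card/subsetP => _ /imsetP[Z + ->].
rewrite !inE subsetIr /= => /andP[/sX ZK /eqP ZY]; apply/asboolP.
move: ZK Z0K => /boolspanP[_ aZ] /boolspanP[_ aZ0].
have [h _] := affspan_off_on KD Kr sp (affspanB aZ aZ0).
apply: affspan_ext (h _) => [A AH|]; first by rewrite !indI.
apply: affspan_ext (affspan_const _ _ _ 0) => A AH.
by rewrite -(indI Z AH) -(indI Z0 AH) ZY Z0Y subrr.
Qed.

Lemma card_sum_fiber X : X \subset bK -> #|X| = (\sum_(Y in bH) #|fiber X Y|)%N.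
Proof.
move=> /subsetP sX; rewrite -sum1_card.
rewrite (partition_big (fun Z => Z :&: H) (mem bH))/=; last first.
  by move=> Z /sX/boolspan_off.
apply: eq_bigr => Y _; rewrite -sum1_card; apply: eq_bigl => Z.
by rewrite inE.
Qed.

Lemma card_boolspan_split : (#|bK| <= 2 ^ #|P| * (#|bH| + #|bP|))%N.
Proof.
rewrite (card_sum_fiber (subxx _)) (big_setID bP)/= (setIidPr boolspanPU).
have -> : (#|bH| = #|bP| + #|bH :\: bP|)%N.
  by rewrite -(cardsID bP bH) (setIidPr boolspanPU).
apply: (@leq_trans (#|bP| * 2 ^ #|P|.+1 + #|bH :\: bP| * 2 ^ #|P|)).
  rewrite -!sum_nat_const; apply: leq_add; apply: leq_sum => Y.
    exact: card_fiber.
  by rewrite inE => /andP[YP _]; apply: card_fiberN.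
rewrite expnS; move: (2 ^ _)%N #|bP| #|_ :\: _| => q m n; nia.
Qed.

Local Notation bF := (facet_family K S).

Lemma facet_sub : bF \subset bK.
Proof. by apply/subsetP => Z; rewrite inE => /andP[]. Qed.

(** The restriction of the indicator of [Z] to [H], extended by 0, stays in the
    span by [affspan_off_only]. It vanishes off [Z], so it is a multiple of the
    indicator of [Z] itself. *)
Lemma facet_on_off Z : Z \in bF -> Z :&: H \in bP ->
  Z :&: H = set0 \/ Z :&: H' = set0.
Proof.
rewrite inE => /and3P[ZK Z0 /asboolP Zf] ZP.
case/boolspanP: ZP => _ aZ.
have [l lE] : exists l, forall A, A \in K ->
    (if x \in A then 0 else ind (Z :&: H) A) = l * ind Z A.
  apply: Zf; first exact: (affspan_off_only sp).
  move=> A AK AZ; case: ifP => // xA; rewrite indI ?inE ?AK ?xA//.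
  by rewrite /indicator (negPf AZ).
have [->|[A]] := set_0Vmem (Z :&: H); first by left.
rewrite inE => /andP[AZ AH]; right; apply/eqP; apply: contraT => /set0Pn[B].
rewrite inE => /andP[BZ]; rewrite inE => /andP[BK xB].
have := lE B BK; rewrite xB /indicator BZ mulr1 => l0.
move: AH; rewrite inE => /andP[AK xA]; have := lE A AK.
rewrite -l0 mul0r (negPf xA) /indicator 2!inE AZ AK xA /= => /eqP.
by rewrite oner_eq0.
Qed.

Lemma card_fiber_facet Y : Y \in bP -> Y != set0 -> (#|fiber bF Y| <= 1)%N.
Proof.
move=> YP Y0; apply: (@leq_trans #|[set Y]|); last by rewrite cards1.
apply/subset_leq_card/subsetP => Z; rewrite in_set1 inE => /andP[ZF /eqP ZY].
have := facet_on_off ZF; rewrite ZY => /(_ YP)[Y00|Z0].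
  by rewrite Y00 eqxx in Y0.
apply/eqP; have ZK := subsetP facet_sub _ ZF.
have sY : Y \subset H by case/boolspanP: YP.
apply: set_on_off; first exact: bK_sub.
- by apply: subset_trans sY _; rewrite on_off_subset.
- by rewrite ZY (setIidPl sY).
- rewrite Z0; apply/esym/eqP; rewrite setI_eq0 disjoints_subset.
  apply: subset_trans sY _; apply/subsetP => A; rewrite !inE => /andP[-> ->].
  by [].
Qed.

Lemma card_fiber_facet0 : (#|fiber bF set0| <= 2 ^ #|P|.+1 - 1)%N.
Proof.
rewrite fiberI; last first.
  move=> Z Z' /(subsetP facet_sub)/bK_sub sZ /(subsetP facet_sub)/bK_sub sZ'.
  exact: set_on_off.
apply: (@leq_trans #|boolspan sgn H' P :\ set0|).
  apply/subset_leq_card/subsetP => _ /imsetP[Z + ->].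
  rewrite inE => /andP[ZF /eqP Z0]; have ZK := subsetP facet_sub _ ZF.
  rewrite in_setD1 -boolspan_off_on// Z0 set0_boolspan andbT.
  move: ZF; rewrite inE => /and3P[_ + _]; apply: contraNneq => Z0'.
  apply/eqP/set_on_off; rewrite ?set0I ?sub0set//; exact: bK_sub.
have := card_boolspan_leq sgn H' P.
rewrite (cardsD1 set0 (boolspan sgn H' P)) set0_boolspan add1n.
move: #|_ :\ _| (2 ^ _)%N => m n; lia.
Qed.

(** The fiber of the restriction to [H] over a nonzero function of the span of
    [P] has at most one element, which vanishes on [H'], and the fiber over 0
    misses 0. Since the span of [P] contains the indicators of [set0] and [H],
    these savings leave at most [2 ^ #|P|] facets per function on [H] on
    average. *)
Lemma card_facet_split : (#|bF| <= 2 ^ #|P| * #|bH|)%N.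
Proof.
rewrite (card_sum_fiber facet_sub) (big_setID bP)/= (setIidPr boolspanPU).
have bP2 : (2 <= #|bP|)%N.
  have H0 : H != set0.
    by apply/set0Pn; exists set0; rewrite inE KD.1 inE.
  have <- : #|[set set0; H]| = 2%N by rewrite cards2 eq_sym H0.
  apply/subset_leq_card/subsetP => Z.
  rewrite in_setU 2!in_set1 => /orP[]/eqP->.
    exact: set0_boolspan.
  exact: setT_boolspan.
have -> : (#|bH| = #|bP| + #|bH :\: bP|)%N.
  by rewrite -(cardsID bP bH) (setIidPr boolspanPU).
have leN : (\sum_(Y in bH :\: bP) #|fiber bF Y| <= #|bH :\: bP| * 2 ^ #|P|)%N.
  rewrite -sum_nat_const; apply: leq_sum => Y; rewrite in_setD => /andP[YP _].
  exact: card_fiberN facet_sub YP.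
have leP : (\sum_(Y in bP) #|fiber bF Y| <=
              2 ^ #|P|.+1 - 1 + (#|bP| - 1))%N.
  rewrite (big_setD1 set0) ?set0_boolspan//=; apply: leq_add.
    exact: card_fiber_facet0.
  have -> : (#|bP| - 1 = #|bP :\ set0|)%N.
    by rewrite [in LHS](cardsD1 set0) set0_boolspan add1n subn1.
  rewrite -sum1_card; apply: leq_sum => Y; rewrite in_setD1 => /andP[Y0 YP].
  exact: card_fiber_facet.
have p1 : (1 <= 2 ^ #|P|)%N by rewrite expn_gt0.
move: leN leP bP2 p1; rewrite expnS.
move: (2 ^ _)%N #|bP| #|_ :\: _| (\sum_(_ in bP) _)%N (\sum_(_ in _) _)%N.
move=> q m n s1 s2; nia.
Qed.

(** [H] has index 2 in [K], and on [H] the elements of [P :|: U] determine the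
    other elements of [S]. *)
Lemma card_traces_off : (#|traces K S| <= 2 * #|traces H (P :|: U)|)%N.
Proof.
have [B BK xB] := splits_xS Kr sp.
have leH : (#|traces H S| <= #|traces H (P :|: U)|)%N.
  pose F (Y : {set E}) := Y :|: pi @: (Y :&: P).
  apply: (@leq_trans #|F @: traces H (P :|: U)|); last exact: leq_imset_card.
  apply/subset_leq_card/subsetP => _ /imsetP[A AH ->]; apply/imsetP.
  exists (A :&: (P :|: U)); first exact: imset_f.
  move: AH; rewrite inE => /andP[AK xA].
  have piA e : e \in P -> (pi e \in A) = (e \in A).
    by move=> /(splits_pi sp)/partnerP->//; rewrite (negPf xA) addbF.
  have [[sPS sUS] sQS] := splits_sub sp.
  apply/setP => e; rewrite /F !inE; apply/idP/idP.
    move=> /andP[eA eS]; move: (eS); rewrite (splits_S sp) !inE.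
    case/or4P => [/eqP ex|->|eQ|->]; rewrite ?eA ?orbT//.
      by rewrite -ex eA in xA.
    case/imsetP: eQ => e' e'P ee'; apply/orP; right; apply/imsetP.
    by exists e' => //; rewrite !inE -piA// -ee' eA e'P.
  case/orP => [/andP[-> /orP[/(subsetP sPS)|/(subsetP sUS)]]//|].
  case/imsetP => e'; rewrite !inE => /andP[/andP[e'A _] e'P] ->.
  by rewrite piA// e'A (subsetP sQS)//; exact: imset_f.
have leH' : (#|traces H' S| <= #|traces H S|)%N.
  pose F (Y : {set E}) := symdiff Y (B :&: S).
  apply: (@leq_trans #|F @: traces H S|); last exact: leq_imset_card.
    apply/subset_leq_card/subsetP => _ /imsetP[A AH' ->]; apply/imsetP.
    exists (symdiff A B :&: S).
      apply: imset_f; move: AH'; rewrite !inE => /andP[AK xA].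
      by rewrite symdiff_closedl// AK xA xB.
    apply/setP => e; rewrite !inE.
    by case: (e \in A); case: (e \in B); case: (e \in S).
have sub : traces K S \subset traces H S :|: traces H' S.
  apply/subsetP => _ /imsetP[A AK ->]; rewrite inE.
  by case/orP: (in_on_off AK) => AH; rewrite ?(imset_f (fun A => A :&: S) AH)
    ?orbT.
have := subset_leq_card sub; have := leq_card_setU (traces H S) (traces H' S).
by move=> [le1 _] le2; lia.
Qed.

Let T2 := [set Y1 :|: Y2 | Y1 in traces H P, Y2 in powerset U].

Let card_T2 : (#|T2| <= 2 ^ #|U| * #|traces H P|)%N.
Proof.
rewrite /T2 curry_imset2X; apply: leq_trans (leq_imset_card _ _) _.
by rewrite cardsX card_powerset mulnC.
Qed.

Let traces_T2 : traces H (P :|: U) \subset T2.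
Proof.
apply/subsetP => _ /imsetP[A AH ->]; apply/imset2P.
exists (A :&: P) (A :&: U); [exact: imset_f|by rewrite inE subsetIr|].
by rewrite setIUr.
Qed.

Lemma card_traces_offP : (#|traces H (P :|: U)| <= 2 ^ #|U| * #|traces H P|)%N.
Proof. exact: leq_trans (subset_leq_card traces_T2) card_T2. Qed.

(** Under this equality the traces of [H] on [P] and on [U] are independent, and
    every subset of [U] occurs. *)
Lemma traces_off_full e : e \in U ->
  #|traces K S| = (2 ^ #|U|.+1 * #|traces H P|)%N ->
  exists2 A, A \in K & A :&: S = [set e].
Proof.
move=> eU cE; have le1 := card_traces_off.
have TE : traces H (P :|: U) = T2.
  apply/eqP; rewrite eqEcard traces_T2 /=.
  by apply: leq_trans card_T2 _; move: le1; rewrite cE expnS -mulnA leq_pmul2l.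
have : [set e] \in T2.
  apply/imset2P; exists set0 [set e]; rewrite ?set0U ?inE ?sub1set//.
  apply/imsetP; exists set0; last by rewrite set0I.
  exact: (symdiff_closed_off x KD).1.
rewrite -TE => /imsetP[A AH /setP eA]; have [[sPS sUS] sQS] := splits_sub sp.
have dPU := splits_PU sp.
have inA e' : e' \in P :|: U -> (e' \in A) = (e' == e).
  by move=> e'PU; move: (eA e'); rewrite in_set1 in_setI e'PU andbT.
move: AH; rewrite inE => /andP[AK xA]; exists A => //.
apply/setP => e'; rewrite in_setI in_set1; apply/andP/eqP => [[e'A]|->].
  rewrite (splits_S sp) in_setU1 in_setU (in_setU _ (pi @: P)).
  case/or4P => [/eqP ex|e'P|/imsetP[e'' e''P ee]|e'U].
  - by rewrite -ex e'A in xA.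
  - by apply/eqP; rewrite -inA ?e'A// inE e'P.
  - move: e'A; rewrite ee (partnerP _ _ _ _ (splits_pi sp e''P))// (negPf xA).
    rewrite addbF inA ?inE ?e''P// => /eqP ee''.
    by rewrite -ee'' (disjointFr dPU e''P) in eU.
  - by apply/eqP; rewrite -inA ?e'A// inE e'U orbT.
by rewrite inA ?eqxx ?inE ?eU ?orbT// (subsetP sUS).
Qed.

End Split.
End Counting.

Section Bounds.
Variables (R : realFieldType) (E : finType).
Implicit Types (A B : {set E}) (K Y Z : {set {set E}}) (S P U : {set E}).

Local Notation sgn := (@parity_char R E).

Lemma splits_cardPU K S x P U pi : splits K S x P U pi ->
  #|P :|: U| = (#|P| + #|U|)%N.
Proof.
by move=> sp; rewrite cardsU (disjoint_setI0 (splits_PU sp)) cards0 subn0.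
Qed.

Section Step.
Variables (K : {set {set E}}) (S P U : {set E}) (x : E) (pi : E -> E).
Hypotheses (KD : symdiff_closed K) (Kr : reduced K S).
Hypothesis sp : splits K S x P U pi.

Local Notation H := (off K x).
Local Notation bK := (#|boolspan sgn K S|).
Local Notation bH := (#|boolspan sgn H (P :|: U)|).
Local Notation bP := (#|boolspan sgn H P|).
Local Notation aK := (#|traces K S|).
Local Notation aH := (#|traces H (P :|: U)|).
Local Notation aP := (#|traces H P|).

Lemma card_traces_step : (aK <= 2 ^ #|U|.+1 * aP)%N.
Proof.
apply: leq_trans (card_traces_off KD Kr sp) _.
by rewrite expnS -mulnA leq_mul2l card_traces_offP.
Qed.

Lemma boolspan_traces_step :
  (bH * aH <= #|P :|: U|.+1 * 2 ^ #|P :|: U|.+1)%N ->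
  (bP * aP <= #|P|.+1 * 2 ^ #|P|.+1)%N ->
  (bK * aK <= #|S|.+1 * 2 ^ #|S|.+1)%N /\
  ((bK * aK = #|S|.+1 * 2 ^ #|S|.+1)%N -> aK = (2 ^ #|U|.+1 * aP)%N).
Proof.
move=> hH hP; have aKP := card_traces_step.
have aKH := card_traces_off KD Kr sp; have bKle := card_boolspan_split R KD Kr sp.
have e1 : (bH * aK <= 2 * (#|P :|: U|.+1 * 2 ^ #|P :|: U|.+1))%N.
  apply: leq_trans (leq_mul (leqnn 2) hH); rewrite mulnCA leq_mul2l aKH.
  by rewrite orbT.
have e2 : (2 ^ #|P| * (bH * aK) <= (#|P| + #|U|).+1 * 2 ^ #|S|.+1)%N.
  apply: leq_trans (leq_mul (leqnn _) e1) _.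
  rewrite (splits_card sp) (splits_cardPU sp).
  have -> : ((1 + 2 * #|P| + #|U|).+1 = #|P| + (#|P| + #|U|).+2)%N by lia.
  by rewrite expnD [(2 ^ _.+2)%N]expnS; apply/eq_leq; ring.
have e3 : (bP * aK <= 2 ^ #|U|.+1 * (#|P|.+1 * 2 ^ #|P|.+1))%N.
  apply: leq_trans (leq_mul (leqnn _) hP); rewrite mulnCA leq_mul2l aKP.
  by rewrite orbT.
have pE : (2 ^ #|P| * (2 ^ #|U|.+1 * (#|P|.+1 * 2 ^ #|P|.+1)) =
           #|P|.+1 * 2 ^ #|S|.+1)%N.
  rewrite mulnA mulnCA -!expnD; congr (_ * 2 ^ _)%N.
  rewrite (splits_card sp); lia.
have cS : (#|S|.+1 = (#|P| + #|U|).+1 + #|P|.+1)%N.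
  rewrite (splits_card sp); lia.
have le : (bK * aK <= 2 ^ #|P| * (bH * aK) + 2 ^ #|P| * (bP * aK))%N.
  by rewrite -mulnDr -mulnDl mulnA leq_mul2r bKle orbT.
split.
  apply: leq_trans le _; rewrite {1}cS mulnDl leq_add// -pE.
  by rewrite leq_mul2l e3 orbT.
move=> tight; apply/eqP; rewrite eqn_leq aKP /=.
move: le; rewrite tight {1}cS mulnDl => le.
have {}le : (#|P|.+1 * 2 ^ #|S|.+1 <= 2 ^ #|P| * (bP * aK))%N.
  by move: le e2; set u := (_ * _)%N; set v := (_ * _)%N;
     set w := (_ * _)%N; set y := (_ * _)%N; lia.
have bP0 : (0 < bP)%N by apply/card_gt0P; exists set0; exact: set0_boolspan.
move: le; rewrite -pE leq_pmul2l ?expn_gt0//.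
move=> /(leq_trans (leq_mul (leqnn (2 ^ #|U|.+1)%N) hP)).
by rewrite mulnCA leq_pmul2l.
Qed.

End Step.

(** There is equality for cubes and for simplices, where [S] is a basis of the
    group of characters, respectively the set of all its nonzero elements. *)
Theorem boolspan_traces_bound K S : symdiff_closed K -> reduced K S ->
  (#|boolspan sgn K S| * #|traces K S| <= #|S|.+1 * 2 ^ #|S|.+1)%N.
Proof.
have [n] := ubnP #|S|; elim: n S K => // n IHn S K /ltnSE leSn KD Kr.
have [->|[x xS]] := set_0Vmem S.
  rewrite card_traces_set0 ?KD.1// cards0 muln1.
  by apply: leq_trans (card_boolspan_leq _ _ _) _; rewrite cards0.
have [P [U [pi sp]]] := splits_exist Kr xS.
have cS := splits_card sp; have cPU := splits_cardPU sp.
have HD := symdiff_closed_off x KD.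
apply: (boolspan_traces_step KD Kr sp _ _).1; apply: IHn => //; try lia.
  exact: reduced_off KD Kr sp.
exact: reduced_offP KD Kr sp.
Qed.

(** In the second alternative, [S] and the trivial character form a group. If
    some [e] in [S] has no partner for [x], then [traces_off_full] gives an [A]
    that meets [S] in [e] alone. Hence [e] is not the sum of two other elements
    of [S], and splitting along [e] yields no pairs: this is the first
    alternative. *)
Lemma boolspan_traces_tight K S : symdiff_closed K -> reduced K S ->
  (#|boolspan sgn K S| * #|traces K S| = #|S|.+1 * 2 ^ #|S|.+1)%N ->
  #|traces K S| = (2 ^ #|S|)%N \/
  (forall x e, x \in S -> e \in S -> e != x ->
     exists2 e', e' \in S & partner K x e e').
Proof.
move=> KD Kr tight.
have tightU x P U pi : splits K S x P U pi ->
    #|traces K S| = (2 ^ #|U|.+1 * #|traces (off K x) P|)%N.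
  move=> sp; have HD := symdiff_closed_off x KD.
  by apply: (boolspan_traces_step KD Kr sp _ _).2 tight;
    apply: boolspan_traces_bound => //;
    [exact: reduced_off KD Kr sp|exact: reduced_offP KD Kr sp].
have [full|nfull] := pselect (#|traces K S| = 2 ^ #|S|)%N; first by left.
right; have noP0 x P U pi : splits K S x P U pi -> P != set0.
  move=> sp; apply/eqP => P0; apply: nfull; rewrite (tightU _ _ _ _ sp) P0.
  rewrite card_traces_set0 ?(symdiff_closed_off x KD).1// (splits_card sp) P0.
  by rewrite cards0 muln0 addn0 muln1 add1n.
move=> x e xS eS ex; have [P [U [pi sp]]] := splits_exist Kr xS.
have [eP|eP] := boolP (e \in P).
  exists (pi e); last exact: splits_pi sp _ eP.
  by apply: (subsetP (splits_sub sp).2); exact: imset_f.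
have [/imsetP[e' e'P ee']|eQ] := boolP (e \in pi @: P).
  exists e'; first exact: (subsetP (splits_sub sp).1.1).
  by apply: partner_sym; rewrite ee'; exact: splits_pi sp _ e'P.
have eU : e \in U.
  move: eS; rewrite (splits_S sp) !in_setU1 in_setU (negPf eP) /= in_setU.
  by rewrite (negPf eQ) (negPf ex).
have [A AK AS] := traces_off_full KD Kr sp eU (tightU _ _ _ _ sp).
have inA e' : e' \in S -> (e' \in A) = (e' == e).
  by move=> e'S; move/setP: AS => /(_ e'); rewrite in_set1 in_setI e'S andbT.
have [P' [U' [pi' sp']]] := splits_exist Kr eS.
have /set0Pn[e' e'P] := noP0 _ _ _ _ sp'.
have [[sP _] sQ] := splits_sub sp'.
have := partnerP _ _ _ _ (splits_pi sp' e'P) _ AK.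
have e'S := subsetP sP _ e'P.
have pe'S : pi' e' \in S by apply/(subsetP sQ)/imset_f.
rewrite !inA// eqxx.
have /negPf-> : e' != e.
  by apply: contraNneq (splits_xPU sp').1 => <-.
have /negPf-> // : pi' e' != e.
apply: contraNneq (splits_xN sp') => pe; rewrite -[X in X \in _]pe.
by rewrite in_setU in_setU imset_f ?orbT.
Qed.

(** The proof gives the bound with [#|S| - #|P|] instead of [#|S|], for any
    splitting of [S]. *)
Lemma facet_traces_bound K S : symdiff_closed K -> reduced K S -> S != set0 ->
  (#|facet_family R K S| * #|traces K S| <= #|S| * 2 ^ #|S|.+1)%N /\
  ((#|facet_family R K S| * #|traces K S| = #|S| * 2 ^ #|S|.+1)%N ->
   forall x P U pi, splits K S x P U pi ->
   [/\ P = set0, #|traces K S| = (2 * #|traces (off K x) U|)%N &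
     (#|boolspan sgn (off K x) U| * #|traces (off K x) U| =
        #|U|.+1 * 2 ^ #|U|.+1)%N]).
Proof.
move=> KD Kr S0.
have main x P U pi : splits K S x P U pi ->
    (#|facet_family R K S| * #|traces K S| <=
       2 ^ #|P| * (#|boolspan sgn (off K x) (P :|: U)| * #|traces K S|))%N /\
    (2 ^ #|P| * (#|boolspan sgn (off K x) (P :|: U)| * #|traces K S|)
      <= (#|P| + #|U|).+1 * 2 ^ #|S|.+1)%N.
  move=> sp; split.
    by rewrite mulnA leq_mul2r (card_facet_split R KD Kr sp) orbT.
  have HD := symdiff_closed_off x KD.
  have hH := boolspan_traces_bound HD (reduced_off KD Kr sp).
  have aKH := card_traces_off KD Kr sp.
  apply: leq_trans (_ : 2 ^ #|P| * (2 * (#|P :|: U|.+1 * 2 ^ #|P :|: U|.+1)) <= _)%N.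
    rewrite leq_mul2l; apply/orP; right.
    apply: leq_trans (leq_mul (leqnn 2) hH); rewrite mulnCA leq_mul2l aKH.
    by rewrite orbT.
  rewrite (splits_card sp) (splits_cardPU sp).
  have -> : ((1 + 2 * #|P| + #|U|).+1 = #|P| + (#|P| + #|U|).+2)%N by lia.
  by rewrite expnD [(2 ^ _.+2)%N]expnS; apply/eq_leq; ring.
split.
  have /set0Pn[x xS] := S0; have [P [U [pi sp]]] := splits_exist Kr xS.
  have [le1 le2] := main _ _ _ _ sp; apply: leq_trans le1 _.
  apply: leq_trans le2 _; rewrite leq_mul2r; apply/orP; right.
  rewrite (splits_card sp); lia.
move=> tight x P U pi sp; have [le1 le2] := main _ _ _ _ sp.
have P0 : P = set0.
  apply/eqP; rewrite -cards_eq0; have := leq_trans le1 le2.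
  rewrite tight leq_pmul2r ?expn_gt0// {1}(splits_card sp); lia.
have cS : #|S| = #|U|.+1 by rewrite (splits_card sp) P0 cards0; lia.
move: le1 le2; rewrite P0 set0U cards0 expn0 mul1n add0n tight cS expnS.
rewrite mulnCA => le1 le2.
have HD := symdiff_closed_off x KD.
have := boolspan_traces_bound HD (reduced_off KD Kr sp).
have := card_traces_off KD Kr sp; rewrite P0 set0U.
have bU0 : (0 < #|boolspan sgn (off K x) U|)%N.
  by apply/card_gt0P; exists set0; exact: set0_boolspan.
move: le1 bU0; set b := #|boolspan _ _ _|; set a := #|traces K S|.
set a' := #|traces _ _|; set w := (_ * 2 ^ _)%N => le1 b0 leaa leb.
have wE : (b * a' = w)%N.
  apply/eqP; rewrite eqn_leq leb /= -(@leq_pmul2l 2)//.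
  apply: leq_trans le1 _; rewrite mulnCA leq_mul2l leaa orbT//.
split=> //; apply/eqP; rewrite eqn_leq leaa /= -(@leq_pmul2l b)// mulnCA wE.
exact: le1.
Qed.

(** [S] behaves as a hyperplane complement in the group of characters: addition
    of [B] is the antipodal map on [K], and the sign vectors of two points that
    are neither equal nor antipodal are orthogonal. *)
Definition antipodal K S : Prop :=
  (exists2 B, B \in K & S \subset B) /\
  {in K, forall A, ~~ (S \subset A) -> A :&: S != set0 ->
    \sum_(e in S) sgn e A = 0}.

(** If [A] contains [e'] but not [e], adding [e] and [e'] permutes [S] and changes
    all the signs at [A], so the signs at [A] add up to 0. The sum of all signs
    over [K] is 0 while [set0] contributes [#|S|], hence some [A] contributes a
    negative amount; such an [A] contains [S]. *)
Lemma antipodal_triples K S : symdiff_closed K -> reduced K S -> S != set0 ->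
  (forall x e e', x \in S -> e \in S -> e' \in S -> exists2 e'', e'' \in S &
    forall A, A \in K -> (e'' \in A) = (e' \in A) (+) (e \in A) (+) (x \in A)) ->
  antipodal K S.
Proof.
move=> KD Kr S0 tri.
have bal : {in K, forall A, ~~ (S \subset A) -> A :&: S != set0 ->
    \sum_(e in S) sgn e A = 0}.
  move=> A AK /subsetPn[e eS eA] /set0Pn[e']; rewrite inE => /andP[e'A e'S].
  have /choice[phi phiP] : forall z, exists z', z \in S -> z' \in S /\
      forall B, B \in K -> (z' \in B) = (e' \in B) (+) (e \in B) (+) (z \in B).
    move=> z; case: (boolP (z \in S)) => [zS|]; last by exists z.
    by have [z' z'S zE] := tri _ _ _ zS eS e'S; exists z'.
  have phiI : {in S &, injective phi}.
    move=> z1 z2 z1S z2S pE; apply: Kr.2 => // B BK.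
    have [_ h1] := phiP _ z1S; have [_ h2] := phiP _ z2S.
    by move: (h1 B BK); rewrite pE h2// => /addbI.
  have phiS : phi @: S = S.
    apply/eqP; rewrite eqEcard card_in_imset// leqnn andbT.
    by apply/subsetP => _ /imsetP[z /phiP[zS _] ->].
  have : \sum_(z in S) sgn z A = - \sum_(z in S) sgn z A; last by lra.
  rewrite -{1}phiS big_imset//= -sumrN; apply: eq_bigr => z zS.
  have [_ zE] := phiP _ zS.
  by rewrite /parity_char zE// e'A (negPf eA) /= signrN.
split=> //.
apply: contrapT => noB.
have : \sum_(A in K) \sum_(e in S) sgn e A > 0.
  rewrite (bigD1 set0) ?KD.1//= ltr_pwDl//.
    under eq_bigr do rewrite /parity_char inE expr0.
    by rewrite sumr_const ltr0n card_gt0.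
  apply: sumr_ge0 => A /andP[AK _].
  have [SA|SA] := boolP (S \subset A); first by case: noB; exists A.
  have [SA0|SA0] := eqVneq (A :&: S) set0; last by rewrite bal.
  apply: sumr_ge0 => e eS; rewrite /parity_char.
  by move/setP: SA0 => /(_ e); rewrite !inE eS andbT => ->.
rewrite exchange_big/= big1 ?ltxx// => e eS.
exact: (sum_sgn R KD Kr eS).
Qed.

(** Tightness on the kernel of [x] makes the sum of two elements of [S], there, an
    element of [S] again. Over [K] the same identity holds up to adding [x], and
    [x] has to be added because no element of [S] is the sum of two others. *)
Lemma facet_traces_tight K S : symdiff_closed K -> reduced K S -> S != set0 ->
  (#|facet_family R K S| * #|traces K S| = #|S| * 2 ^ #|S|.+1)%N ->
  #|traces K S| = (2 ^ #|S|)%N \/ antipodal K S.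
Proof.
move=> KD Kr S0 tight.
have := (facet_traces_bound KD Kr S0).2 tight => {}tight.
have [full|nfull] := pselect (#|traces K S| = 2 ^ #|S|)%N; first by left.
right; have splitU x : x \in S -> exists pi, splits K S x set0 (S :\ x) pi.
  move=> xS; have [P [U [pi sp]]] := splits_exist Kr xS; exists pi.
  have [P0 _ _] := tight _ _ _ _ sp; move: sp; rewrite P0 => sp.
  suff -> : S :\ x = U by [].
  rewrite (splits_S sp) imset0 !set0U setU1K//.
  by rewrite (splits_xPU sp).2.
have tri x e e' : x \in S -> e \in S -> e' \in S -> e != x -> e' != x ->
    e' != e -> exists2 e'', e'' \in S &
    forall A, A \in K -> (e'' \in A) = (e' \in A) (+) (e \in A) (+) (x \in A).
  move=> xS eS e'S ex e'x ee'; have [pi sp] := splitU _ xS.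
  have [_ aE tU] := tight _ _ _ _ sp; have HD := symdiff_closed_off x KD.
  have Ur := reduced_off KD Kr sp; rewrite set0U in Ur.
  have [full|] := boolspan_traces_tight HD Ur tU.
    by case: nfull; rewrite aE full (cardsD1 x S) xS add1n expnS.
  move=> /(_ e e'); rewrite !in_setD1 ex eS e'x e'S => /(_ isT isT ee').
  move=> [e'']; rewrite in_setD1 => /andP[e''x e''S] /partnerP pe''.
  exists e'' => //.
  have [] := @additive_off E K x
      (fun A => (e'' \in A) (+) ((e' \in A) (+) (e \in A))) KD.
  - move=> A B _ _; rewrite !in_symdiff; rewrite (addbACA (e' \in A)).
    by rewrite [RHS]addbACA.
  - by move=> A AH; rewrite pe''// addbb.
  - move=> e0; have [pi' sp'] := splitU _ eS.
    have e'U : e' \in S :\ e by rewrite in_setD1 ee' e'S.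
    case/negP: (splits_U sp' e'U e''S); apply/partnerP => A AK.
    have := e0 A AK.
    by case: (e'' \in A); case: (e' \in A); case: (e \in A).
  move=> eE A AK; rewrite -(eE A AK).
  by case: (e'' \in A); case: (e' \in A); case: (e \in A).
apply: antipodal_triples => // x e e' xS eS e'S.
have [->|ex] := eqVneq e x.
  by exists e' => // A _; rewrite -addbA addbb addbF.
have [->|e'x] := eqVneq e' x.
  by exists e => // A _; rewrite addbAC addbb addFb.
have [->|ee'] := eqVneq e' e; first by exists x => // A _; rewrite addbb.
exact: tri.
Qed.

End Bounds.

(** * Cycles of binary matroids *)

Section BinaryCycles.
Variables (E : finType) (r : nat) (v : E -> 'cV['F_2]_r).
Implicit Types (A B C X : {set E}).

Let I := vector_family v.

(** Over GF(2) a linear relation is the subset of its nonzero coefficients. *)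
Lemma dependent_subset_sum A :
  reflect (exists2 B : {set E}, B \subset A & (B != set0) && (\sum_(e in B) v e == 0))
          (A \notin I).
Proof.
have tE (k : 'I_#|A| -> 'F_2) :
    \sum_(i < #|A|) k i *: (map_tuple v (enum_tuple A))`_i =
    \sum_(i < #|A|) k i *: v (enum_val i).
  apply: eq_bigr => i _; congr (_ *: _).
  rewrite (nth_map (enum_val i)) -?enum_val_nth//.
  by rewrite -cardE ltn_ord.
rewrite inE; apply: (iffP idP) => [nfree|[B /subsetP sBA /andP[B0 /eqP sB]]].
  have /existsNP[k /not_implyP[k0 /existsNP[i /eqP ki]]] : ~ forall k : 'I_#|A| -> 'F_2,
      \sum_(i < #|A|) k i *: (map_tuple v (enum_tuple A))`_i = 0 ->
      forall i, k i = 0.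
    by move=> /freeP fA; rewrite fA in nfree.
  exists [set enum_val j | j in [set j | k j != 0]].
    by apply/subsetP => _ /imsetP[j _ ->]; exact: enum_valP.
  apply/andP; split.
    by apply/set0Pn; exists (enum_val i); apply: imset_f; rewrite inE.
  rewrite big_imset/=; last by move=> ? ? _ _ /enum_val_inj.
  apply/eqP; transitivity (\sum_(j < #|A|) k j *: v (enum_val j)); last by rewrite -tE.
  rewrite [LHS]big_mkcond; apply: eq_bigr => j _; rewrite inE.
  have [->|kj] /= := eqVneq (k j) 0; first by rewrite scale0r.
  suff -> : k j = 1 by rewrite scale1r.
  by move: kj; case: (k j) => -[|[|m]] lm // _; apply: val_inj.
apply/negP => fA.
have /freeP : free (map_tuple v (enum_tuple A)) by [].
move=> /(_ (fun i => (enum_val i \in B)%:R)); rewrite tE.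
have [e eB] := set0Pn _ B0; have eA := sBA _ eB.
move=> /(_ _ (enum_rank_in eA e)); rewrite enum_rankK_in// eB => h.
suff /h/eqP : \sum_(i < #|A|) (enum_val i \in B)%:R *: v (enum_val i) = 0.
  by rewrite oner_eq0.
rewrite -(big_enum_val (fun e => (e \in B)%:R *: v e))/= -[RHS]sB.
rewrite [LHS]big_mkcond [RHS]big_mkcond; apply: eq_bigr => e' _.
case: (boolP (e' \in B)) => [/sBA ->|_]; first by rewrite scale1r.
by rewrite scale0r if_same.
Qed.

Lemma circuit_sum X : circuit I X -> (X != set0) * (\sum_(e in X) v e = 0).
Proof.
move=> /minsetP[/dependent_subset_sum[B sBX /andP[B0 sB]] minX].
have BE : B = X.
  by apply: minX => //; apply/dependent_subset_sum; exists B => //; rewrite B0.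
by rewrite -BE B0 (eqP sB).
Qed.

(** Removing a circuit from a set with zero sum leaves a set with zero sum. *)
Lemma is_cycleP C : is_cycle I C <-> \sum_(e in C) v e = 0.
Proof.
split=> [[Q QP Qc]|].
  rewrite -(cover_partition QP) big_trivIset ?(partition_trivIset QP)//=.
  by apply: big1 => X /Qc/circuit_sum[].
have [n] := ubnP #|C|; elim: n C => // n IHn C /ltnSE leCn sC.
have [->|C0] := eqVneq C set0.
  exists set0; first by rewrite partition_set0.
  by move=> X; rewrite inE.
have /(@minset_exists _ (fun A => A \notin I))[X Xc sXC] : C \notin I.
  by apply/dependent_subset_sum; exists C => //; rewrite C0 sC eqxx.
have [X0 sX] := circuit_sum Xc.
have sCX : \sum_(e in C :\: X) v e = 0.
  by move: sC; rewrite (big_setID X)/= (setIidPr sXC) sX add0r.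
have [|Q QP Qc] := IHn _ _ sCX.
  apply: leq_trans leCn; rewrite -(cardsID X C) (setIidPr sXC).
  by rewrite -[ltnLHS]add0n ltn_add2r card_gt0.
exists (X |: Q).
  have -> : C = X :|: C :\: X.
    by apply/setP => e; rewrite !inE; have := subsetP sXC e; case: (e \in X) => // ->.
  apply: partitionU1 => //; rewrite disjoints_subset.
  by apply/subsetP => e eX; rewrite !inE eX.
by move=> Y; rewrite in_setU1 => /orP[/eqP->|/Qc].
Qed.

Lemma symdiff_sum A B :
  \sum_(e in symdiff A B) v e = \sum_(e in A) v e + \sum_(e in B) v e.
Proof.
rewrite [LHS]big_mkcond [X in _ = X + _]big_mkcond [X in _ = _ + X]big_mkcond.
rewrite -big_split/=; apply: eq_bigr => e _.
rewrite in_symdiff; case: (e \in A); case: (e \in B); rewrite ?add0r ?addr0//=.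
by rewrite -mulr2n -scaler_nat pchar_Fp_0// scale0r.
Qed.

End BinaryCycles.

Definition cycle_space (E : finType) (I : {set {set E}}) : {set {set E}} :=
  [set C | `[< is_cycle I C >]].

Lemma cycle_spaceP (E : finType) (I : {set {set E}}) C :
  reflect (is_cycle I C) (C \in cycle_space I).
Proof. by rewrite inE; exact: asboolP. Qed.

Lemma symdiff_closed_cycles (E : finType) (I : {set {set E}}) :
  binary I -> symdiff_closed (cycle_space I).
Proof.
move=> [r [v ->]]; split=> [|A B /cycle_spaceP + /cycle_spaceP].
  by apply/cycle_spaceP/is_cycleP; rewrite big_set0.
move=> /is_cycleP sA /is_cycleP sB.
by apply/cycle_spaceP/is_cycleP; rewrite symdiff_sum sA sB addr0.
Qed.

(** * Hulls of finite families, faces and dimension *)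

From mathcomp Require Import finmap classical_sets functions cardinality.

Definition points (T : finType) (W : Type) (D : {set T}) (p : T -> W) : set W :=
  [set p A | A in [set` D]]%classic.

Section FiniteHulls.
Variables (R : realType) (V : vectType R) (T : finType).
Implicit Types (D : {set T}) (p : T -> V).

Lemma convex_hullP D p (y : V) : convex_hull (points D p) y <->
  exists w : T -> R, [/\ forall A, A \in D -> 0 <= w A, \sum_(A in D) w A = 1 &
    y = \sum_(A in D) w A *: p A].
Proof.
split=> [[n [x [a [xD a0 a1 ->]]]]|[w [w0 w1 ->]]].
  have /choice[f fP] : forall i : 'I_n, exists A, A \in D /\ p A = x i.
    by move=> i; have [A AD AE] := xD i; exists A.
  exists (fun A => \sum_(i | f i == A) a i); split.
  - by move=> A _; apply: sumr_ge0.
  - rewrite -[RHS]a1 (partition_big f (mem D))//= => i _.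
    by have [] := fP i.
  - rewrite (partition_big f (mem D))/=; last by move=> i _; have [] := fP i.
    apply: eq_bigr => A _; rewrite scaler_suml; apply: eq_bigr => i /eqP <-.
    by have [_ ->] := fP i.
exists #|D|, (fun i => p (enum_val i)), (fun i => w (enum_val i)); split.
- by move=> i; exists (enum_val i) => //; exact: enum_valP.
- by move=> i; exact/w0/enum_valP.
- by rewrite -(big_enum_val w).
- by rewrite (big_enum_val (fun A => w A *: p A)).
Qed.

Lemma convex_hull_mono (S S' : set V) y :
  (forall x, S x -> S' x) -> convex_hull S y -> convex_hull S' y.
Proof.
move=> SS' [n [x [a [xS a0 a1 yE]]]]; exists n, x, a; split=> // i; exact: SS'.
Qed.

Lemma affine_hull_mono (S S' : set V) y :
  (forall x, S x -> S' x) -> affine_hull S y -> affine_hull S' y.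
Proof.
move=> SS' [n [x [a [xS a1 yE]]]]; exists n, x, a; split=> // i; exact: SS'.
Qed.

Lemma convex_hull_point D p A : A \in D -> convex_hull (points D p) (p A).
Proof.
move=> AD; apply/convex_hullP; exists (fun B => (B == A)%:R); split.
- by move=> B _; exact: ler0n.
- rewrite (bigD1 A)//= eqxx big1 ?addr0// => B /andP[_ /negPf->//].
- rewrite (bigD1 A)//= eqxx scale1r big1 ?addr0// => B /andP[_ /negPf->].
  by rewrite scale0r.
Qed.

Lemma convex_hull_midpoint D p y z : convex_hull (points D p) y ->
  convex_hull (points D p) z -> convex_hull (points D p) (2^-1 *: y + 2^-1 *: z).
Proof.
move=> /convex_hullP[u [u0 u1 ->]] /convex_hullP[v [v0 v1 ->]].
apply/convex_hullP; exists (fun A => 2^-1 * u A + 2^-1 * v A); split.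
- by move=> A AD; rewrite addr_ge0// mulr_ge0 ?u0 ?v0// invr_ge0.
- by rewrite big_split/= -!mulr_sumr u1 v1; field.
- rewrite !scaler_sumr -big_split/=; apply: eq_bigr => A _.
  by rewrite !scalerA scalerDl.
Qed.

Lemma affine_hullP D p (y : V) : affine_hull (convex_hull (points D p)) y <->
  exists w : T -> R, \sum_(A in D) w A = 1 /\ y = \sum_(A in D) w A *: p A.
Proof.
split=> [[n [x [a [xD a1 ->]]]]|[w [w1 ->]]].
  have /choice[f fP] : forall i : 'I_n, exists w : T -> R,
      \sum_(A in D) w A = 1 /\ x i = \sum_(A in D) w A *: p A.
    by move=> i; have /convex_hullP[w [_ w1 ->]] := xD i; exists w.
  exists (fun A => \sum_i a i * f i A); split.
    rewrite exchange_big/= -[RHS]a1; apply: eq_bigr => i _.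
    by rewrite -mulr_sumr (fP i).1 mulr1.
  under [RHS]eq_bigr do rewrite scaler_suml.
  rewrite exchange_big/=; apply: eq_bigr => i _.
  by rewrite (fP i).2 scaler_sumr; apply: eq_bigr => A _; rewrite scalerA.
exists #|D|, (fun i => p (enum_val i)), (fun i => w (enum_val i)); split.
- by move=> i; apply: convex_hull_point; exact: enum_valP.
- by rewrite -(big_enum_val w).
- by rewrite (big_enum_val (fun A => w A *: p A)).
Qed.

Lemma convex_hull_linear (W : lmodType R) D p (w : T -> R) (f : {linear V -> W}) :
  f (\sum_(A in D) w A *: p A) = \sum_(A in D) w A *: f (p A).
Proof. by rewrite linear_sum; apply: eq_bigr => A _; rewrite linearZ. Qed.

End FiniteHulls.

Section Dimension.
Variables (R : realType) (V : vectType R).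
Implicit Types (S : set V) (U : {vspace V}).

Lemma affine_hull_sub S x : S x -> affine_hull S x.
Proof.
move=> Sx; exists 1%N, (fun=> x), (fun=> 1); split=> //.
- by rewrite big_ord1.
- by rewrite big_ord1 scale1r.
Qed.

Lemma affine_hull_nonempty S x : affine_hull S x -> exists y, S y.
Proof.
move=> [[|n] [y [a [yS a1 _]]]]; last by exists (y ord0).
by move/eqP: a1; rewrite big_ord0 eq_sym oner_eq0.
Qed.

Lemma has_dimP S k x : S x -> has_dim S k <->
  exists2 U : {vspace V}, \dim U = k & forall y, affine_hull S y <-> y - x \in U.
Proof.
move=> Sx; split=> [[x0 [U [aE dU]]]|[U dU aE]].
  exists U => // y; rewrite aE.
  have : affine_hull S x by exact: affine_hull_sub.
  rewrite aE => -[u /= uU xE]; split=> [[u' /= u'U <-]|yU].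
    by rewrite -xE opprD addrACA subrr add0r rpredB.
  exists (y - x + u); first by rewrite /= rpredD.
  by rewrite /= -xE [x0 + _]addrC -!addrA (addrC u) [- _ + _]addrC subrr addr0.
exists x, U; split=> //; apply/seteqP; split=> y /=.
  by move=> /aE yU; exists (y - x) => //; rewrite addrC subrK.
by move=> [u /= uU <-]; apply/aE; rewrite addrC addrA addNr add0r.
Qed.

Lemma has_dim_nonempty S k : has_dim S k -> exists x, S x.
Proof.
move=> [x0 [U [aE _]]]; apply: (@affine_hull_nonempty S x0).
by rewrite aE; exists 0; rewrite /= ?rpred0 ?addr0.
Qed.

Lemma has_dim_uniq S k l : has_dim S k -> has_dim S l -> k = l.
Proof.
move=> Sk Sl; have [x Sx] := has_dim_nonempty Sk.
move: Sk Sl => /(has_dimP _ Sx)[U <- UE] /(has_dimP _ Sx)[U' <- U'E].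
congr (\dim _); apply/vspaceP => y; rewrite -[y](addrK x).
by apply/idP/idP => [/UE/U'E|/U'E/UE].
Qed.

End Dimension.

Section Functionals.
Variables (R : realType) (E : finType).
Local Notation V := {ffun E -> R^o}.

Definition dotp (a : E -> R) (v : V) : R := \sum_e a e * v e.

Lemma dotp_is_linear a : linear_for *%R (dotp a).
Proof.
move=> k u v; rewrite /dotp mulr_sumr -big_split/=; apply: eq_bigr => e _.
by rewrite !ffunE /= mulrDr; congr (_ + _); rewrite mulrCA.
Qed.

HB.instance Definition _ a :=
  GRing.isLinear.Build R V R *%R (dotp a) (dotp_is_linear a).

Definition unit_vector (e : E) : V := [ffun e' => (e' == e)%:R].

Lemma unit_vector_sum (v : V) : v = \sum_e v e *: unit_vector e.
Proof.
apply/ffunP => e; rewrite sum_ffunE (bigD1 e)//= !ffunE eqxx /= big1 ?addr0.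
  by rewrite /GRing.scale/= mulr1.
by move=> e' /negPf ne; rewrite !ffunE eq_sym ne /GRing.scale/= mulr0.
Qed.

Lemma scalar_dotp (c : {scalar V}) v : c v = dotp (fun e => c (unit_vector e)) v.
Proof.
rewrite {1}[v]unit_vector_sum linear_sum; apply: eq_bigr => e _.
by rewrite linearZ/= mulrC.
Qed.

(** Take a nonzero coordinate of the difference of [v] and its projection to
    [U]. *)
Lemma separating_functional (U : {vspace V}) (v : V) : v \notin U ->
  exists a : E -> R, (forall u, u \in U -> dotp a u = 0) /\ dotp a v != 0.
Proof.
move=> vU; pose w := v - projv U v.
have [e we] : exists e, w e != 0.
  apply/existsP; apply: contraT; rewrite negb_exists => /forallP w0.
  case/negP: vU; suff -> : v = projv U v by exact: memv_proj.
  apply/eqP; rewrite -subr_eq0; apply/eqP/ffunP => e; rewrite [RHS]ffunE.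
  by apply/eqP; have := w0 e; rewrite negbK.
pose a e' := (unit_vector e' - projv U (unit_vector e')) e.
have aE u : dotp a u = (u - projv U u) e.
  rewrite {2 3}[u]unit_vector_sum linear_sum -sumrB sum_ffunE.
  apply: eq_bigr => e' _; rewrite linearZ -scalerBr ffunE.
  by rewrite /a /GRing.scale/= mulrC.
exists a; split=> [u uU|]; last by rewrite aE.
by rewrite aE projv_id// subrr ffunE.
Qed.

End Functionals.

Section Faces.
Variables (R : realType) (V : vectType R) (T : finType).
Variables (D : {set T}) (p : T -> V).
Local Notation P := (convex_hull (points D p)).

Lemma convex_hull1 (A : T) : convex_hull (points (finset.set1 A) p) = [set p A]%classic.
Proof.
apply/seteqP; split=> y /=.
  move=> /convex_hullP[w [_ w1 ->]]; move: w1; rewrite !big_set1 => ->.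
  by rewrite scale1r.
by move=> ->; apply: convex_hull_point; rewrite finset.inE.
Qed.

(** At a convex combination, [delta - c] is the combination of its values at the
    points, which are nonnegative. So it is 0 only if all the weight is on the
    points where it is 0. *)
Lemma face_hull (c : {scalar V}) (delta : R) :
  (forall A, A \in D -> c (p A) <= delta) ->
  (forall y, P y -> c y <= delta) /\
  (P `&` [set y | c y = delta] =
     convex_hull (points [set A in D | c (p A) == delta]%SET p))%classic.
Proof.
move=> cD.
have gap w : \sum_(A in D) w A = 1 ->
    delta - c (\sum_(A in D) w A *: p A) = \sum_(A in D) w A * (delta - c (p A)).
  move=> w1; rewrite linear_sum -[X in X - _]mulr1 -w1 mulr_sumr -sumrB.
  by apply: eq_bigr => A _; rewrite linearZ/= mulrBr [delta * _]mulrC.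
split=> [y /convex_hullP[w [w0 w1 ->]]|].
  rewrite -subr_ge0 gap//; apply: sumr_ge0 => A AD.
  by rewrite mulr_ge0 ?w0// subr_ge0 cD.
have subD : {subset [set A in D | c (p A) == delta]%SET <= D}.
  by move=> A; rewrite finset.inE => /andP[].
apply/seteqP; split=> y /=.
  move=> [/convex_hullP[w [w0 w1 yE]] cy].
  have sum0 : \sum_(A in D) w A * (delta - c (p A)) = 0.
    by rewrite -gap// -yE cy subrr.
  have h0 A : A \in D -> 0 <= w A * (delta - c (p A)).
    by move=> AD; rewrite mulr_ge0 ?w0// subr_ge0 cD.
  have wc A : A \in D -> c (p A) != delta -> w A = 0.
    move=> AD cA; have /eqP := psumr_eq0P h0 sum0 AD.
    by rewrite mulf_eq0 subr_eq0 [delta == _]eq_sym (negPf cA) orbF => /eqP.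
  have dropD (W : nmodType) (f : T -> W) :
      (forall A, A \in D -> c (p A) != delta -> f A = 0) ->
      \sum_(A in D) f A = \sum_(A in [set A in D | c (p A) == delta]%SET) f A.
    move=> f0; rewrite (big_setID [set A in D | c (p A) == delta]%SET)/=.
    rewrite [X in _ + X]big1 ?addr0.
      by apply: eq_bigl => A; rewrite !finset.inE; case: (A \in D).
    move=> A; rewrite !finset.inE negb_and => /andP[+ AD].
    by rewrite AD => /f0->.
  apply/convex_hullP; exists w; split.
  - by move=> A /subD/w0.
  - by rewrite -dropD// .
  - rewrite -dropD// => A AD cA; by rewrite wc// scale0r.
move=> yc; split.
  by apply: convex_hull_mono yc => x [A AD <-]; exists A => //=; exact: subD.
have [w [_ w1 ->]] := (convex_hullP _ _ _).1 yc.
rewrite linear_sum -[RHS]mul1r -w1 mulr_suml; apply: eq_bigr => A.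
by rewrite finset.inE => /andP[_ /eqP cA]; rewrite linearZ/= cA.
Qed.

Lemma faceP F : face P F -> exists (c : {scalar V}) (delta : R),
  (forall A, A \in D -> c (p A) <= delta) /\
  F = convex_hull (points [set A in D | c (p A) == delta]%SET p).
Proof.
move=> [c [delta [cP ->]]]; have cD A : A \in D -> c (p A) <= delta.
  by move=> AD; apply: cP; exact: convex_hull_point.
by exists c, delta; split=> //; rewrite (face_hull cD).2.
Qed.

Lemma face_of_functional (c : {scalar V}) (delta : R) (Z : {set T}) :
  (forall A, A \in D -> c (p A) <= delta) ->
  Z = [set A in D | c (p A) == delta]%SET -> face P (convex_hull (points Z p)).
Proof.
move=> cD ->; exists c, delta; have [h1 h2] := face_hull cD.
by split.
Qed.

Lemma convex_hull_nonempty (Z : {set T}) y :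
  convex_hull (points Z p) y -> exists A, A \in Z.
Proof.
move=> /convex_hullP[w [_ w1 _]]; apply/set0Pn; apply: contra_eq_neq w1 => ->.
by rewrite big_set0 eq_sym oner_neq0.
Qed.

Lemma vertex_point v : vertex P v -> exists2 A, A \in D & v = p A.
Proof.
move=> /faceP[c [delta [cD vE]]].
have : [set v]%classic v by [].
rewrite vE => /convex_hull_nonempty[A AZ]; exists A.
  by move: AZ; rewrite finset.inE => /andP[].
have := convex_hull_point p AZ; rewrite -vE.
by move=> /= ->.
Qed.

Lemma spanP (q : T -> V) y :
  y \in <<[seq q A | A <- enum D]>>%VS <->
  exists w : T -> R, y = \sum_(A in D) w A *: q A.
Proof.
split=> [yU|[w ->]]; last first.
  apply: rpred_sum => A AD; apply/rpredZ/memv_span.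
  by apply: map_f; rewrite mem_enum.
pose X := map_tuple q (enum_tuple D).
exists (fun A => \sum_(i < #|D| | enum_val i == A) coord X i y).
have : y \in <<X>>%VS by [].
move/coord_span => yE; rewrite {1}yE.
rewrite (partition_big (fun i => enum_val i) (mem D))/=.
  apply: eq_bigr => A AD; rewrite scaler_suml; apply: eq_bigr => i /eqP <-.
  rewrite (nth_map (enum_val i)) -?enum_val_nth//.
  by rewrite -cardE ltn_ord.
by move=> i _; exact: enum_valP.
Qed.

Lemma affine_hull_span (A0 : T) (y : V) : A0 \in D ->
  affine_hull P y <-> y - p A0 \in <<[seq p A - p A0 | A <- enum D]>>%VS.
Proof.
move=> A0D; rewrite (spanP (fun A => p A - p A0)) affine_hullP.
split=> [[w [w1 ->]]|[w yE]].
  exists w; rewrite -[X in _ - X]scale1r -w1 scaler_suml -sumrB.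
  by apply: eq_bigr => A _; rewrite scalerBr.
exists (fun A => w A + (A == A0)%:R * (1 - \sum_(B in D) w B)).
have pick (W : lmodType R) (z : R) (f : T -> W) :
    \sum_(A in D) ((A == A0)%:R * z) *: f A = z *: f A0.
  rewrite (bigD1 A0)//= eqxx mul1r big1 ?addr0// => A /andP[_ /negPf->].
  by rewrite mul0r scale0r.
split.
  rewrite big_split/=.
  have := pick R^o (1 - \sum_(B in D) w B) (fun=> 1).
  rewrite /GRing.scale/=; under eq_bigr do rewrite mulr1.
  by rewrite mulr1 => ->; rewrite addrC subrK.
under eq_bigr do rewrite scalerDl.
rewrite big_split/= pick -[LHS](subrK (p A0)) yE.
rewrite scalerBl scale1r addrCA addrC; congr (_ + _).
rewrite scaler_suml -sumrB; apply: eq_bigr => A _; exact: scalerBr.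
Qed.

End Faces.

Lemma dim_add_line (K : fieldType) (V : vectType K) (U : {vspace V}) (w : V) :
  w \notin U -> \dim (U + <[w]>) = (\dim U).+1.
Proof.
move=> wU; have w0 : w != 0 by apply: contraNneq wU => ->; rewrite mem0v.
rewrite dimv_disjoint_sum ?dim_vline ?w0 ?addn1//.
apply/eqP; rewrite -subv0; apply/subvP => v; rewrite memv_cap memv0.
move=> /andP[vU /vlineP[k vE]]; rewrite vE in vU *.
have [->|k0] := eqVneq k 0; first by rewrite scale0r.
by case/negP: wU; rewrite -(scalerK k0 w) rpredZ.
Qed.

Lemma card_points (T : finType) (W : choiceType) (D : {set T}) (p : T -> W) :
  {in D &, injective p} -> #|` fset_set (points D p)| = #|D|.
Proof.
move=> pI; have -> : points D p = [set` [fset p A | A in D]%fset]%classic.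
  apply/seteqP; split=> y /=.
    by move=> [A AD <-]; apply/imfsetP; exists A.
  by move=> /imfsetP[A AD ->]; exists A.
by rewrite set_fsetK card_in_imfset//= cardE.
Qed.

(** * Vertices, dimension and facets *)

Section Representatives.
Variable E : finType.
Implicit Types (K : {set {set E}}) (S : {set E}).

(** [S] contains one element from each class of elements with the same nontrivial
    character on [K]. *)
Definition represents K S : Prop :=
  reduced K S /\
  forall e, (forall A, A \in K -> e \notin A) \/
    exists2 e', e' \in S & forall A, A \in K -> (e \in A) = (e' \in A).

Lemma represents_exist K : exists S, represents K S.
Proof.
have r0 : `[< reduced K finset.set0 >].
  by apply/asboolP; split=> [e|e e']; rewrite finset.inE.
have [S /maxsetP[/asboolP Sr maxS]] :=
  ex_maxset (ex_intro (fun S => is_true `[< reduced K S >]) _ r0).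
exists S; split=> // e.
have [/exists_inP[B BK eB]|] := boolP [exists A in K, e \in A]; last first.
  by rewrite negb_exists_in => /forall_inP e0; left.
right; apply: contrapT => nrep.
have nE e' : e' \in S -> ~ forall A, A \in K -> (e \in A) = (e' \in A).
  by move=> e'S h; apply: nrep; exists e'.
have eS : e \notin S by apply/negP => /nE; apply.
suff /asboolP/maxS/(_ (finset.subsetUr _ _)) eqS : reduced K (e |: S).
  by move: eS; rewrite -eqS setU11.
split=> [e'|e1 e2]; rewrite !in_setU1.
  by move=> /orP[/eqP->|/Sr.1//]; exists B.
move=> /orP[/eqP->|e1S] /orP[/eqP->|e2S] //.
- by move=> h; case: (nE _ e2S).
- by move=> h; case: (nE _ e1S) => A AK; rewrite h.
- exact: Sr.2.
Qed.

Lemma card_traces K S : represents K S -> #|traces K S| = #|K|.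
Proof.
move=> [_ rep]; rewrite /traces card_in_imset// => A B AK BK /setP AB.
apply/setP => e; have [e0|[e' e'S eE]] := rep e.
  by rewrite (negPf (e0 _ AK)) (negPf (e0 _ BK)).
by rewrite !eE//; move: (AB e'); rewrite !finset.inE e'S !andbT.
Qed.

End Representatives.

Section CyclePolytope.
Variables (R : realType) (E : finType) (K : {set {set E}}) (S : {set E}).
Hypotheses (KD : symdiff_closed K) (Srep : represents K S).

Local Notation V := {ffun E -> R^o}.
Local Notation char := (@char_vector R E).
Local Notation P := (convex_hull (points K char)).
Local Notation sgn := (@parity_char R E).

Let Sr : reduced K S := Srep.1.

Lemma char0 : char finset.set0 = 0.
Proof. by apply/ffunP => e; rewrite !ffunE finset.inE. Qed.

Lemma char_inj : injective char.
Proof.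
move=> A B /ffunP AB; apply/setP => e; have := AB e; rewrite !ffunE.
exact: natr_bool_inj.
Qed.

Lemma char_sgn (e : E) (A : {set E}) : char A e = (1 - sgn e A) / 2.
Proof.
by rewrite ffunE /parity_char; case: (e \in A); rewrite ?expr0 ?expr1 /=; field.
Qed.

(** On the unit cube this functional has its unique maximum at the vertex of
    [A]. *)
Definition corner (A : {set E}) (e : E) : R := if e \in A then 1 else -1.

Lemma dotp_corner A B :
  dotp (corner A) (char B) = #|A|%:R - #|symdiff A B|%:R.
Proof.
rewrite /dotp -!sum1_card !natr_sum [X in X - _]big_mkcond [X in _ - X]big_mkcond.
rewrite -sumrB; apply: eq_bigr => e _; rewrite ffunE /corner in_symdiff.
by case: (e \in A); case: (e \in B) => /=; ring.
Qed.

Lemma dotp_corner_eq A B : (dotp (corner A) (char B) == #|A|%:R) = (A == B).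
Proof.
rewrite dotp_corner -[X in _ == X]subr0 (inj_eq (subrI _)) pnatr_eq0 cards_eq0.
apply/eqP/eqP => [/setP AB|->]; apply/setP => e.
  move: (AB e); rewrite in_symdiff finset.inE.
  by case: (e \in A); case: (e \in B).
by rewrite in_symdiff addbb finset.inE.
Qed.

Lemma dotp_corner_le A B : dotp (corner A) (char B) <= #|A|%:R.
Proof. by rewrite dotp_corner lerBlDr lerDl ler0n. Qed.

Lemma vertex_char (D : {set {set E}}) A : A \in D ->
  vertex (convex_hull (points D char)) (char A).
Proof.
move=> AD; rewrite /vertex -(convex_hull1 char A).
apply: (face_of_functional (c := dotp (corner A)) (delta := #|A|%:R)).
  by move=> B _; exact: dotp_corner_le.
apply/setP => B; rewrite !finset.inE dotp_corner_eq eq_sym.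
by case: eqVneq => [<-|]; rewrite ?AD ?andbF.
Qed.

Lemma convex_hull_char (D : {set {set E}}) A :
  convex_hull (points D char) (char A) -> A \in D.
Proof.
move=> hA.
have [_ h2] := @face_hull R _ _ D char (dotp (corner A)) #|A|%:R
  (fun B _ => dotp_corner_le A B).
have : (convex_hull (points D char) `&` [set y | dotp (corner A) y = #|A|%:R])%classic (char A).
  by split=> //=; apply/eqP; rewrite dotp_corner_eq.
rewrite h2 => /convex_hull_nonempty[B]; rewrite finset.inE dotp_corner_eq.
by move=> /andP[BD /eqP->].
Qed.

Lemma vertices_char (D : {set {set E}}) :
  [set v | vertex (convex_hull (points D char)) v]%classic = points D char.
Proof.
apply/seteqP; split=> v /=; first by move=> /vertex_point[A AD ->]; exists A.
by move=> [A AD <-]; exact: vertex_char.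
Qed.

Lemma num_vertices_char (D : {set {set E}}) :
  num_vertices (convex_hull (points D char)) = #|D|.
Proof.
by rewrite /num_vertices vertices_char card_points// => A B _ _ /char_inj.
Qed.

(** The coordinate at [e] is an affine function of the sign of [e]. *)
Lemma affspan_affine (g : {set E} -> R) :
  affspan sgn K S g <-> exists (b : R) (a : E -> R),
    forall A, A \in K -> g A = b + dotp a (char A).
Proof.
split=> [[a0 [a gE]]|[b [a gE]]].
  exists (a0 + \sum_(e in S) a e), (fun e => if e \in S then -2 * a e else 0).
  move=> A AK; rewrite gE// -addrA; congr (_ + _).
  rewrite /dotp [X in _ + X](_ : _ = \sum_(e in S) -2 * a e * char A e).
    by rewrite -big_split/=; apply: eq_bigr => e _; rewrite char_sgn; field.
  rewrite [RHS]big_mkcond; apply: eq_bigr => e _.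
  by case: ifP; rewrite ?mul0r.
apply: (@affspan_ext _ _ _ _ _ _ (fun A => b + \sum_e a e * char A e)).
  by move=> A AK; rewrite gE.
apply: affspanD; first exact: affspan_const.
apply: affspan_sum => e _; apply: affspanZ.
have [e0|[e' e'S eE]] := Srep.2 e.
  apply: affspan_ext (affspan_const _ _ _ 0) => A /e0 /negPf eA.
  by rewrite ffunE eA.
apply: (@affspan_ext _ _ _ _ _ _ (fun A => 2^-1 * (1 - sgn e' A))).
  move=> A /eE eA; have <- : sgn e A = sgn e' A by rewrite /parity_char eA.
  by rewrite char_sgn mulrC.
apply: affspanZ; apply: affspanB; first exact: affspan_const.
exact: affspan_gen.
Qed.

(** Orthogonality of characters makes these vectors of the linear hull dual to
    the coordinates in [S]. *)
Let dual_vector (e : E) : V :=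
  \sum_(A in K) (- 2 / #|K|%:R * sgn e A) *: char A.

Lemma sum_char_coord (w : {set E} -> R) (D : {set {set E}}) e :
  (\sum_(A in D) w A *: char A) e = \sum_(A in D) w A * char A e.
Proof. by rewrite sum_ffunE; apply: eq_bigr => A _; rewrite ffunE. Qed.

Lemma sum_char_trivial (w : {set E} -> R) e :
  (forall A, A \in K -> e \notin A) -> (\sum_(A in K) w A *: char A) e = 0.
Proof.
move=> e0; rewrite sum_char_coord big1// => A /e0/negPf eA.
by rewrite ffunE eA mulr0.
Qed.

Lemma sum_char_parallel (w : {set E} -> R) e e' :
  (forall A, A \in K -> (e \in A) = (e' \in A)) ->
  (\sum_(A in K) w A *: char A) e = (\sum_(A in K) w A *: char A) e'.
Proof.
move=> ee'; rewrite !sum_char_coord; apply: eq_bigr => A /ee' eA.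
by rewrite !ffunE eA.
Qed.

Let dual_vectorE e e' : e \in S -> e' \in S -> dual_vector e e' = (e == e')%:R.
Proof.
move=> eS e'S; rewrite sum_char_coord.
have K0 := card_symdiff_closed R KD.
transitivity (- #|K|%:R^-1 * \sum_(A in K) (sgn e A - sgn e A * sgn e' A)).
  rewrite mulr_sumr; apply: eq_bigr => A _; rewrite char_sgn.
  by field; rewrite K0.
rewrite sumrB (sum_sgn R KD Sr eS) (sgn_orthogonal R KD Sr eS e'S) sub0r mulrNN.
by rewrite mulrC mulfK.
Qed.

Lemma has_dim_hull : has_dim P #|S|.
Proof.
have K0 := KD.1; have P0 : P 0 by rewrite -char0; exact: convex_hull_point.
apply/(has_dimP _ P0).
exists <<[seq dual_vector e | e <- enum S]>>%VS.
  have -> : [seq dual_vector e | e <- enum S] =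
    map_tuple dual_vector (enum_tuple S) :> seq _ by [].
  have /eqP-> : free (map_tuple dual_vector (enum_tuple S)).
    apply/freeP => k k0 i.
    have /(congr1 (fun v : V => v (enum_val i))) := k0.
    rewrite sum_ffunE ffunE (bigD1 i)//= big1 ?addr0 => [|j ji].
      rewrite (nth_map (enum_val i)) -?enum_val_nth; last by rewrite -cardE ltn_ord.
      rewrite ffunE dual_vectorE ?enum_valP// eqxx => <-.
      by rewrite /GRing.scale/= mulr1.
    rewrite (nth_map (enum_val i)) -?enum_val_nth; last by rewrite -cardE ltn_ord.
    rewrite ffunE dual_vectorE ?enum_valP// (inj_eq enum_val_inj) (negPf ji).
    by rewrite /GRing.scale/= mulr0.
  by rewrite size_tuple.
move=> y; have affE := affine_hull_span char y K0.
rewrite char0 subr0 in affE; rewrite subr0; split.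
  move=> /affE/spanP[w yE].
  have -> : y = \sum_(e in S) y e *: dual_vector e.
    have {}yE : y = \sum_(A in K) w A *: char A.
      by rewrite yE; apply: eq_bigr => A _; rewrite subr0.
    have coordS e : e \in S -> y e = (\sum_(e in S) y e *: dual_vector e) e.
      move=> eS; rewrite sum_ffunE (bigD1 e)//= ffunE dual_vectorE// eqxx.
      rewrite big1 ?addr0 => [|e' /andP[e'S /negPf e'e]].
        by rewrite /GRing.scale/= mulr1.
      by rewrite ffunE dual_vectorE// e'e /GRing.scale/= mulr0.
    have dE : \sum_(e in S) y e *: dual_vector e =
       \sum_(A in K) (\sum_(e in S) y e * (- 2 / #|K|%:R * sgn e A)) *: char A.
      under [RHS]eq_bigr do rewrite scaler_suml.
      rewrite exchange_big/=; apply: eq_bigr => e _; rewrite scaler_sumr.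
      by apply: eq_bigr => A _; rewrite scalerA.
    apply/ffunP => e; have [e0|[e' e'S eE]] := Srep.2 e.
      by rewrite dE {1}yE !sum_char_trivial.
    by rewrite dE {1}yE !(@sum_char_parallel _ e e')// -yE -dE -coordS.
  apply: rpred_sum => e eS; apply/rpredZ/memv_span.
  by apply: map_f; rewrite mem_enum.
move=> /spanP[w yE]; apply/affE/spanP.
exists (fun A => \sum_(e in S) w e * (- 2 / #|K|%:R * sgn e A)).
rewrite yE; under [RHS]eq_bigr do rewrite scaler_suml.
rewrite exchange_big/=; apply: eq_bigr => e _; rewrite scaler_sumr.
by apply: eq_bigr => A _; rewrite scalerA subr0.
Qed.

End CyclePolytope.

Section Facets.
Variables (R : realType) (E : finType) (K : {set {set E}}) (S : {set E}).
Hypotheses (KD : symdiff_closed K) (Srep : represents K S).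

Local Notation V := {ffun E -> R^o}.
Local Notation char := (@char_vector R E).
Local Notation P := (convex_hull (points K char)).
Local Notation sgn := (@parity_char R E).
Local Notation ind := (@indicator R {set E}).

Definition subface (Z : {set {set E}}) : set V :=
  convex_hull (points (K :\: Z)%SET char).

Lemma subface_inj (Z Z' : {set {set E}}) :
  Z \subset K -> Z' \subset K -> subface Z = subface Z' -> Z = Z'.
Proof.
have half (X Y : {set {set E}}) :
    X \subset K -> subface X = subface Y -> {subset X <= Y}.
  move=> /fintype.subsetP sX XY A AX; apply: contraT => AY.
  have : subface Y (char A).
    by apply: convex_hull_point; rewrite finset.in_setD AY sX.
  by rewrite -XY => /convex_hull_char; rewrite finset.in_setD AX.
move=> sZ sZ' ZZ'; apply/finset.setP => A; apply/idP/idP; apply: half => //.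
Qed.

(** Let [U'] be the direction of the subface and [w] a vector leading from it to a
    point off it. If they did not span the direction [U] of the polytope, an
    affine function vanishing on the subface and at that point, but not on [P],
    would contradict [supports_facet]. *)
Lemma facet_of_family (Z : {set {set E}}) : S != finset.set0 ->
  Z \in facet_family R K S -> facet P (subface Z).
Proof.
move=> S0; rewrite finset.inE => /and3P[/boolspanP[sZ aZ] Z0 /asboolP Zf].
have [b [a indE]] := (affspan_affine Srep (ind Z)).1 aZ.
have [A0 A0K A0Z] : exists2 A0, A0 \in K & A0 \notin Z.
  apply/exists_inP; apply: contraT; rewrite negb_exists_in => /forall_inP KZ.
  have /set0Pn[e eS] := S0; have [B BK eB] := Srep.1.1 _ eS.
  have [l lE] : exists l, forall A, A \in K -> sgn e A = l * ind Z A.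
    apply: Zf => [|A /KZ]; first exact: affspan_gen.
    by rewrite negbK => ->.
  have := lE _ KD.1; have := lE _ BK; rewrite /indicator.
  have := KZ _ KD.1; have := KZ _ BK; rewrite !negbK => -> ->.
  by rewrite !mulr1 /parity_char eB finset.inE expr1 expr0; lra.
have ZK A : A \in Z -> A \in K by move/(fintype.subsetP sZ).
split.
  have dotN A : dotp (fun e => - a e) (char A) = - dotp a (char A).
    by rewrite /dotp -sumrN; apply: eq_bigr => e _; rewrite mulNr.
  apply: (face_of_functional (c := dotp (fun e => - a e)) (delta := b)).
    move=> A AK; rewrite /= dotN -subr_ge0 opprK -indE//; exact: ler0n.
  apply/finset.setP => A; rewrite !finset.inE andbC.
  case: (boolP (A \in K)) => //= AK; rewrite dotN eq_sym -subr_eq0 opprK -indE//.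
  by rewrite /indicator pnatr_eq0 eqb0.
exists #|S|.-1; last first.
  rewrite prednK ?card_gt0//; exact: has_dim_hull KD Srep.
have A0F : A0 \in (K :\: Z)%SET by rewrite finset.inE A0Z.
have FA0 : subface Z (char A0) by exact: convex_hull_point.
apply/(has_dimP _ FA0).
set x0 := char A0; set U' := <<[seq char A - x0 | A <- enum (K :\: Z)%SET]>>%VS.
exists U'; last by move=> y; exact: affine_hull_span.
have PA0 : P x0 by exact: convex_hull_point.
have /(has_dimP _ PA0)[U dU UE] := has_dim_hull R KD Srep.
have KU A : A \in K -> char A - x0 \in U.
  by move=> AK; apply/UE/affine_hull_sub/convex_hull_point.
have /set0Pn[B BZ] := Z0; set w := char B - x0.
have aU' u : u \in U' -> dotp a u = 0.
  move=> /(spanP _ (fun A => char A - x0))[c ->]; rewrite linear_sum big1// => A.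
  rewrite finset.inE => /andP[AZ AK]; rewrite linearZ/= linearB/=.
  have := indE A AK; have := indE A0 A0K; rewrite /indicator (negPf A0Z) (negPf AZ).
  move=> e1 e2; rewrite [X in _ * X](_ : _ = 0) ?mulr0//; lra.
have aw : dotp a w = 1.
  have := indE B (ZK _ BZ); have := indE A0 A0K.
  by rewrite /indicator (negPf A0Z) BZ -/x0 /w /= => e1 e2; rewrite linearB/=; lra.
have wU' : w \notin U'.
  by apply/negP => /aU'/eqP; rewrite aw oner_eq0.
suff UE' : U = (U' + <[w]>)%VS.
  by have := dim_add_line wU'; rewrite -UE' dU => ->.
apply/eqP; rewrite eqEsubv; apply/andP; split; last first.
  rewrite subv_add -memvE KU ?ZK// andbT; apply/span_subvP => u /mapP[A].
  by rewrite mem_enum finset.inE => /andP[_ AK] ->; exact: KU.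
apply/subvP => u uU.
have : affine_hull P (u + x0) by apply/UE; rewrite addrK.
move=> /(affine_hull_span _ _ A0K)/spanP[c]; rewrite addrK => ->.
apply: rpred_sum => A AK; apply: rpredZ; apply: contraT => /separating_functional.
move=> [a' [a'0 a'A]].
have [l lE] : exists l, forall A, A \in K ->
    dotp a' (char A - x0) = l * ind Z A.
  apply: Zf => [|A' A'K A'Z].
    apply/(affspan_affine Srep); exists (- dotp a' x0), a' => A' _.
    by rewrite linearB/= addrC.
  apply: a'0; apply: (subvP (addvSl _ _)); apply: memv_span.
  by apply: (map_f (fun A => char A - x0)); rewrite mem_enum finset.inE A'Z.
have l0 : l = 0.
  have := lE B (ZK _ BZ); rewrite /indicator BZ mulr1 => <-.
  by apply: a'0; rewrite -[char B - x0]add0r memv_add ?mem0v ?memv_line.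
by move: a'A; rewrite lE// l0 mul0r eqxx.
Qed.

(** Two-levelness gives [c] a single value on the vertices off [F], so [delta - c]
    is proportional to their indicator. The direction of [F] has codimension 1 in
    that of [P], so an affine function that vanishes on [F] is determined by its
    value at one point off [F]. *)
Lemma family_of_facet F : two_level P -> facet P F ->
  exists2 Z, Z \in facet_family R K S & F = subface Z.
Proof.
move=> P2 Ff; have [t tP] := P2 _ Ff; case: Ff => Fface [k Fk Pk].
have [c [delta [cK FE]]] := faceP Fface.
pose Z : {set {set E}} := [set A in K | c (char A) != delta]%SET.
have KZ : (K :\: Z = [set A in K | c (char A) == delta])%SET.
  apply/finset.setP => A; rewrite !finset.inE; case: (A \in K) => //=.
  by rewrite ?andbT ?andbF negbK.
have {}FE : F = subface Z by rewrite /subface KZ.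
exists Z => //.
have [A0 A0F] : exists A0, A0 \in (K :\: Z)%SET.
  by have [y] := has_dim_nonempty Fk; rewrite FE => /convex_hull_nonempty.
have [A0Z A0K] : A0 \notin Z /\ A0 \in K by move: A0F; rewrite finset.inE => /andP.
have cA A : A \in K -> A \notin Z -> c (char A) = delta.
  by move=> AK; rewrite finset.inE AK negbK => /eqP.
have sZ : Z \subset K by apply/fintype.subsetP => A; rewrite finset.inE => /andP[].
have ZK A : A \in Z -> A \in K by move/(fintype.subsetP sZ).
have [B BZ] : exists B, B \in Z.
  apply/set0Pn; apply/eqP => Z00; move: Fk; rewrite FE /subface Z00 finset.setD0.
  by move=> /(has_dim_uniq Pk); lia.
have cF y : affine_hull F y -> c y = delta.
  rewrite FE => /affine_hullP[w [w1 ->]]; rewrite linear_sum -[RHS]mul1r -w1.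
  rewrite mulr_suml; apply: eq_bigr => A.
  by rewrite finset.inE linearZ => /andP[AZ AK]; rewrite /= cA.
have cZ A : A \in Z -> c (char A) = c t + delta.
  move=> AZ; have vA : vertex P (char A) by apply: vertex_char; exact: ZK.
  have nFA : ~ F (char A).
    by rewrite FE => /convex_hull_char; rewrite finset.inE AZ.
  by have [y yF <-] := tP _ vA nFA; rewrite linearD/= (cF _ yF).
have ct : c t < 0.
  have cB : c (char B) != delta by move: BZ; rewrite finset.inE => /andP[].
  by have := cK _ (ZK _ BZ); rewrite le_eqVlt (negPf cB) /= cZ//; lra.
pose a e := c (unit_vector R e).
have cE v : c v = dotp a v by exact: scalar_dotp.
have indE A : A \in K -> ind Z A = (delta - c (char A)) / (- c t).
  move=> AK; rewrite /indicator; case: (boolP (A \in Z)) => AZ.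
    rewrite cZ// (_ : delta - (c t + delta) = - c t); last by ring.
    by rewrite divff// oppr_eq0 lt_eqF.
  by rewrite cA// subrr mul0r.
rewrite finset.inE; apply/and3P; split.
- apply/boolspanP; split=> //.
  apply: (@affspan_ext _ _ _ _ _ _ (fun A => (- c t)^-1 * (delta - c (char A)))).
    by move=> A AK; rewrite indE// mulrC.
  apply: affspanZ; apply/(affspan_affine Srep).
  exists delta, (fun e => - a e) => A _; rewrite cE /dotp -sumrN; congr (_ + _).
  by apply: eq_bigr => e _; rewrite mulNr.
- by apply/set0Pn; exists B.
apply/asboolP => g /(affspan_affine Srep)[b [a' gE]] g0.
exists (g B) => A AK.
set x0 := char A0.
have FA0 : F x0 by rewrite FE; exact: convex_hull_point.
have PA0 : P x0 by exact: convex_hull_point.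
have /(has_dimP _ FA0)[U' dU' U'E] := Fk.
have /(has_dimP _ PA0)[U dU UE] := Pk.
pose w := char B - x0.
have KU A' : A' \in K -> char A' - x0 \in U.
  by move=> A'K; apply/UE/affine_hull_sub/convex_hull_point.
have cU' u : u \in U' -> c u = 0.
  move=> uU'; have : affine_hull F (u + x0) by apply/U'E; rewrite addrK.
  by move/cF; rewrite linearD/= (cA A0)// => e1; lra.
have wU' : w \notin U'.
  apply/negP => /cU'; rewrite linearB/= cZ// (cA A0)// addrK => /eqP.
  by rewrite lt_eqF.
have a'F y : affine_hull F y -> b + dotp a' y = 0.
  rewrite FE => /affine_hullP[w' [w1 ->]]; rewrite linear_sum -[b]mul1r -w1.
  rewrite mulr_suml -big_split/= big1// => A'.
  rewrite finset.inE linearZ => /andP[A'Z A'K]; rewrite /= -mulrDr -gE// g0//.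
  by rewrite mulr0.
have sU : (U' + <[w]> <= U)%VS.
  rewrite subv_add -memvE KU ?ZK// andbT; apply/subvP => u uU'.
  rewrite -[u](addrK x0); apply/UE; have /U'E : u + x0 - x0 \in U' by rewrite addrK.
  apply: affine_hull_mono => y; rewrite FE.
  apply: convex_hull_mono => z [A' A'F <-]; exists A' => //=.
  by move: A'F; rewrite /= finset.inE => /andP[].
have UE' : U = (U' + <[w]>)%VS.
  by apply/esym/eqP; rewrite eqEdim sU dU dim_add_line// dU' /=.
have := KU A AK; rewrite UE' => /memv_addP[u uU' [_ /vlineP[s ->] Au]].
have a'u : dotp a' u = 0.
  have : affine_hull F (u + x0) by apply/U'E; rewrite addrK.
  move/a'F; have := a'F _ (affine_hull_sub FA0).
  by rewrite linearD/=; lra.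
have cAE : char A = u + s *: w + x0 by rewrite -Au subrK.
have gx0 : g A0 = 0 by exact: g0.
have dA : dotp a' (char A) = s * (dotp a' (char B) - dotp a' x0) + dotp a' x0.
  by rewrite cAE linearD/= linearD/= linearZ/= linearB/= a'u add0r.
have dcA : c (char A) = s * c t + delta.
  rewrite cAE linearD/= linearD/= linearZ/= linearB/= cU'// cZ// (cA A0)//.
  by rewrite addrK add0r.
have := gE A0 A0K; rewrite gx0 -/x0 => e1.
rewrite indE// (gE A)// (gE B) ?ZK// dA dcA.
have -> : b = - dotp a' x0 by lra.
by field; rewrite lt_eqF.
Qed.

Lemma num_facets_family : S != finset.set0 -> two_level P ->
  num_facets P = #|facet_family R K S|.
Proof.
move=> S0 P2.
have -> : num_facets P = #|` fset_set (points (facet_family R K S) subface)|%fset.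
  rewrite /num_facets; congr (#|` fset_set _|)%fset; apply/seteqP; split=> F /=.
    by move=> /(family_of_facet P2)[Z ZF ->]; exists Z.
  by move=> [Z ZF <-]; exact: facet_of_family.
apply: card_points => Z Z'; rewrite !finset.inE.
by move=> /andP[/andP[sZ _] _] /andP[/andP[sZ' _] _]; apply: subface_inj.
Qed.

End Facets.

(** * Cubes and cross-polytopes *)

Section AffineMaps.
Variables (R : realType) (E : finType) (d : nat).
Local Notation V := {ffun E -> R^o}.
Local Notation W := {ffun 'I_d -> R^o}.

Definition coord_map (a : 'I_d -> E -> R) (v : V) : W :=
  [ffun i => dotp (a i) v : R^o].

Lemma coord_map_is_linear a : linear (coord_map a).
Proof.
move=> k u v; apply/ffunP => i; rewrite !ffunE linearD/= linearZ/=.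
by [].
Qed.

HB.instance Definition _ a :=
  GRing.isLinear.Build R V W *:%R (coord_map a) (coord_map_is_linear a).

Lemma linear_coord (f : {linear V -> W}) (i : 'I_d) :
  exists a : E -> R, forall v, f v i = dotp a v.
Proof.
exists (fun e => f (unit_vector R e) i) => v.
rewrite {1}[v]unit_vector_sum linear_sum sum_ffunE; apply: eq_bigr => e _.
by rewrite linearZ ffunE /GRing.scale/= mulrC.
Qed.

End AffineMaps.

Lemma affine_comb (R : realType) (V W : vectType R) (T : finType) (D : {set T})
    (p : T -> V) (w : T -> R) (f : {linear V -> W}) (b : W) :
  \sum_(A in D) w A = 1 ->
  f (\sum_(A in D) w A *: p A) + b = \sum_(A in D) w A *: (f (p A) + b).
Proof.
move=> w1; rewrite convex_hull_linear -[b in LHS]scale1r -w1 scaler_suml.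
by rewrite -big_split/=; apply: eq_bigr => A _; rewrite scalerDr.
Qed.

(** The cross-polytope is the unit ball of the 1-norm. *)
Lemma cross_norm (R : realType) (d : nat) (y : {ffun 'I_d -> R^o}) :
  cross_polytope R d y <-> \sum_i `|y i : R| <= 1.
Proof.
split=> [yc|y1 x xc].
  pose x : {ffun 'I_d -> R^o} := [ffun i => Num.sg (y i : R)].
  have xc : cube R d x.
    by move=> i; rewrite ffunE; case: sgrP => _ /=; apply/andP; split; lra.
  apply: le_trans (yc _ xc); apply: ler_sum => i _.
  by rewrite ffunE normrEsg.
apply: le_trans y1; apply: ler_sum => i _; have /andP[x1 x2] := xc i.
apply: le_trans (ler_norm _) _; rewrite normrM ler_piMl// ler_norml; exact/andP.
Qed.

Section CubeWeights.
Variables (R : realType) (d : nat) (y : 'I_d -> R).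

(** The product of probability measures on the signs 1 and -1 with means
    [y i]. *)
Definition cube_weight (s : {ffun 'I_d -> bool}) : R :=
  \prod_i ((1 + y i * (-1) ^+ s i) / 2).

Lemma sum_cube_weight : \sum_s cube_weight s = 1.
Proof.
rewrite -(bigA_distr_bigA (fun i (b : bool) => (1 + y i * (-1) ^+ b) / 2)).
by apply: big1 => i _; rewrite big_bool /= expr0 expr1; field.
Qed.

Lemma sum_cube_weight_sign j :
  \sum_s cube_weight s * (-1) ^+ s j = y j.
Proof.
pose F i (b : bool) := (1 + y i * (-1) ^+ b) / 2 * (if i == j then (-1) ^+ b else 1).
transitivity (\sum_(s : {ffun 'I_d -> bool}) \prod_i F i (s i)).
  apply: eq_bigr => s _; rewrite /F big_split/=; congr (_ * _).
  rewrite (bigD1 j)//= eqxx big1 ?mulr1// => i /negPf->//.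
rewrite -bigA_distr_bigA (bigD1 j)//= [X in _ * X]big1 ?mulr1 => [|i /negPf ij].
  by rewrite big_bool /F eqxx /= expr0 expr1; field.
by rewrite big_bool /F ij /= expr0 expr1; field.
Qed.

Lemma cube_weight_ge0 s : (forall i, -1 <= y i <= 1) -> 0 <= cube_weight s.
Proof.
move=> y1; apply: prodr_ge0 => i _; have := y1 i.
by case: (s i); rewrite ?expr0 ?expr1; lra.
Qed.

End CubeWeights.

Section Isomorphisms.
Variables (R : realType) (E : finType) (K : {set {set E}}) (S : {set E}).
Hypotheses (KD : symdiff_closed K) (Srep : represents K S).

Local Notation V := {ffun E -> R^o}.
Local Notation char := (@char_vector R E).
Local Notation P := (convex_hull (points K char)).
Local Notation sgn := (@parity_char R E).
Local Notation d := #|S|.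
Local Notation W := {ffun 'I_d -> R^o}.

Lemma eq_on_hull (v v' : V) : P v -> P v' -> (forall e, e \in S -> v e = v' e) ->
  v = v'.
Proof.
move=> /convex_hullP[w [_ _ vE]] /convex_hullP[w' [_ _ v'E]] vv'.
apply/ffunP => e; have [e0|[e' e'S eE]] := Srep.2 e.
  by rewrite vE v'E !sum_char_trivial.
by rewrite vE v'E !(@sum_char_parallel _ _ _ _ e e')// -vE -v'E vv'.
Qed.

Lemma trace_eq A B : A \in K -> B \in K ->
  (forall e, e \in S -> (e \in A) = (e \in B)) -> A = B.
Proof.
move=> AK BK AB; apply: (@char_inj R); apply: eq_on_hull.
- exact: convex_hull_point.
- exact: convex_hull_point.
by move=> e eS; rewrite !ffunE AB.
Qed.

Lemma isomorphic_cube : #|K| = (2 ^ d)%N -> affinely_isomorphic P (cube R d).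
Proof.
move=> cK; pose a (i : 'I_d) (e : E) : R := if e == enum_val i then -2 else 0.
pose b : W := [ffun => 1].
have fE (v : V) i : (coord_map a v + b) i = 1 - 2 * v (enum_val i).
  rewrite !ffunE /dotp (bigD1 (enum_val i))//= big1 ?addr0.
    by rewrite /a eqxx addrC mulNr.
  by move=> e /negPf ne; rewrite /a ne mul0r.
have fsum (w : {set E} -> R) i : \sum_(A in K) w A = 1 ->
    (coord_map a (\sum_(A in K) w A *: char A) + b) i =
    \sum_(A in K) w A * sgn (enum_val i) A.
  move=> w1; rewrite fE sum_char_coord -[X in X - _]w1 mulr_sumr -sumrB.
  by apply: eq_bigr => A _; rewrite char_sgn; field.
exists (coord_map a), b; split.
- move=> v /convex_hullP[w [w0 w1 ->]] i; rewrite fsum//; apply/andP.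
  have sgn1 A e : -1 <= sgn e A <= 1.
    by rewrite /parity_char; case: (e \in A); rewrite ?expr0 ?expr1; lra.
  split.
    rewrite -w1 -sumrN; apply: ler_sum => A AK.
    by have := sgn1 A (enum_val i); have := w0 A AK; nra.
  rewrite -w1; apply: ler_sum => A AK.
  by have := sgn1 A (enum_val i); have := w0 A AK; nra.
- move=> v v' /set_mem Pv /set_mem Pv' /= vv'; apply: eq_on_hull => // e eS.
  have := congr1 (fun u : W => u (enum_rank_in eS e)) vv'.
  by rewrite /= !fE enum_rankK_in//; lra.
move=> y yC.
pose tr (A : {set E}) : {ffun 'I_d -> bool} := [ffun i => enum_val i \in A].
have trI : {in K &, injective tr}.
  move=> A B AK BK /ffunP AB; apply: trace_eq => // e eS.
  by have := AB (enum_rank_in eS e); rewrite !ffunE enum_rankK_in.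
have trK : tr @: K = [set: {ffun 'I_d -> bool}]%SET.
  apply/eqP; rewrite finset.eqEcard finset.subsetT card_in_imset// cK cardsT.
  by rewrite card_ffun card_bool card_ord /=.
have sumK (F : {ffun 'I_d -> bool} -> R) :
    \sum_(A in K) F (tr A) = \sum_s F s.
  rewrite -(big_imset F trI)/= trK; apply: eq_bigl => s.
  by rewrite finset.in_setT.
pose yr i : R := y i.
exists (\sum_(A in K) cube_weight yr (tr A) *: char A).
  apply/convex_hullP; exists (fun A => cube_weight yr (tr A)); split=> //.
    by move=> A _; apply: cube_weight_ge0.
  by rewrite (sumK (cube_weight yr)) sum_cube_weight.
apply/ffunP => i; rewrite fsum; last by rewrite (sumK (cube_weight yr)) sum_cube_weight.
rewrite -[RHS](sum_cube_weight_sign yr i) -(sumK (fun s => cube_weight yr s * (-1) ^+ s i)).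
by apply: eq_bigr => A _; rewrite ffunE.
Qed.

Section Cross.
Hypotheses (S0 : S != finset.set0) (bal : antipodal R K S).
Variable B : {set E}.
Hypotheses (BK : B \in K) (SB : S \subset B).

Let d_gt0 : (0 < d)%N. Proof. by rewrite card_gt0. Qed.

Let sgnB e A : e \in S -> sgn e (symdiff A B) = - sgn e A.
Proof.
by move=> eS; rewrite sgn_symdiff {2}/parity_char (fintype.subsetP SB)// expr1 mulrN1.
Qed.

Lemma sum_sgn_antipodal A : A \in K ->
  \sum_(e in S) sgn e A = d%:R * ((A == finset.set0)%:R - (A == B)%:R).
Proof.
move=> AK; have B0 : B != finset.set0.
  have /set0Pn[e eS] := S0; apply/set0Pn; exists e; exact: (fintype.subsetP SB).
have [->|A0] := eqVneq A finset.set0.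
  rewrite eq_sym (negPf B0) subr0 mulr1 -sumr_const.
  by apply: eq_bigr => e _; rewrite /parity_char finset.inE.
have [->|AB] := eqVneq A B.
  rewrite sub0r mulrN1 -sumr_const -sumrN; apply: eq_bigr => e eS.
  by rewrite /parity_char (fintype.subsetP SB).
rewrite subrr mulr0; apply: bal.2 => //.
  apply: contra AB => /fintype.subsetP SA; apply/eqP/trace_eq => // e eS.
  by rewrite SA// (fintype.subsetP SB).
apply: contra A0 => /eqP/finset.setP A0; apply/eqP/trace_eq => //.
  exact: KD.1.
by move=> e eS; have := A0 e; rewrite !finset.inE eS andbT.
Qed.

Lemma card_antipodal : #|K| = (2 * d)%N.
Proof.
have B0 : B != finset.set0.
  have /set0Pn[e eS] := S0; apply/set0Pn; exists e; exact: (fintype.subsetP SB).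
have : \sum_(A in K) (\sum_(e in S) sgn e A) * (\sum_(e in S) sgn e A) =
    #|K|%:R * d%:R.
  under eq_bigr do rewrite big_distrlr/=.
  rewrite exchange_big/=; under eq_bigr do rewrite exchange_big/=.
  rewrite -[RHS]mulr1 -mulrA mulrC -mulrA mulrC mul1r mulr_natr -sumr_const.
  apply: eq_bigr => e eS.
  rewrite (bigD1 e)//= (sgn_orthogonal R KD Srep.1)// eqxx mul1r big1 ?addr0//.
  move=> e' /andP[e'S /negPf e'e].
  by rewrite (sgn_orthogonal R KD Srep.1)// eq_sym e'e mul0r.
rewrite (bigD1 finset.set0) ?KD.1//= (bigD1 B) ?BK//= [X in _ + (_ + X)]big1 => [|A].
  rewrite !sum_sgn_antipodal ?KD.1// !eqxx (negPf B0).
  rewrite [finset.set0 == B]eq_sym (negPf B0) => sumE.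
  have dR : d%:R != 0 :> R by rewrite pnatr_eq0 -lt0n.
  apply/eqP; rewrite -(eqr_nat R) natrM; apply/eqP/(mulIf dR).
  by rewrite -sumE /=; ring.
move=> /andP[/andP[AK A0] AB].
by rewrite sum_sgn_antipodal// (negPf A0) (negPf AB) subrr mulr0 mul0r.
Qed.

(** [h] lists one point of each antipodal pair, for instance the one that avoids
    a given element of [S]. *)
Lemma antipodal_index : exists h : 'I_d -> {set E},
  [/\ injective h, forall i, h i \in K,
      forall i j, h i != symdiff (h j) B &
      forall A, A \in K -> exists i, A = h i \/ A = symdiff (h i) B].
Proof.
have /set0Pn[e0 e0S] := S0; have e0B := fintype.subsetP SB _ e0S.
have onE : on K e0 = [set symdiff A B | A in off K e0]%SET.
  apply/finset.setP => A; apply/idP/imsetP => [|[A' + ->]]; rewrite finset.inE.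
    move=> /andP[AK e0A]; exists (symdiff A B); last by rewrite symdiffKr.
    by rewrite finset.inE symdiff_closedl// AK in_symdiff e0A e0B.
  move=> /andP[AK e0A].
  by rewrite finset.inE symdiff_closedl// AK in_symdiff (negPf e0A) e0B.
have cK : #|off K e0| = d.
  have : #|K| = (#|off K e0| + #|on K e0|)%N.
    rewrite -(cardsID [set A : {set E} | e0 \notin A]%SET K); congr (_ + _)%N; apply: eq_card => A;
    by rewrite !finset.inE; case: (e0 \in A); case: (A \in K).
  have -> : #|on K e0| = #|off K e0|.
    by rewrite onE card_imset//; exact: inv_inj (symdiffKr B).
  by rewrite card_antipodal; move: #|off K e0| d => m n; lia.
pose h i : {set E} := enum_val (cast_ord (esym cK) i).
have hP i : (h i \in K) /\ e0 \notin h i.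
  by have := enum_valP (cast_ord (esym cK) i); rewrite finset.inE => /andP.
exists h; split.
- by move=> i j /enum_val_inj/cast_ord_inj.
- by move=> i; have [] := hP i.
- move=> i j; apply: contraNneq (hP i).2 => ->.
  by rewrite in_symdiff (negPf (hP j).2) e0B.
have offE A : A \in off K e0 -> exists i, A = h i.
  move=> AH; exists (cast_ord cK (enum_rank_in AH A)).
  by rewrite /h cast_ordK enum_rankK_in.
move=> A AK; case: (boolP (e0 \in A)) => e0A; last first.
  by have [|i ->] := offE A; [rewrite finset.inE AK|exists i; left].
have : A \in on K e0 by rewrite finset.inE AK.
by rewrite onE => /imsetP[A' /offE[i ->] ->]; exists i; right.
Qed.

(** The coordinates of the image are the normalized scalar products with the sign
    vectors of the points [h i]. As these are pairwise orthogonal, [h i] goes to a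
    unit vector and its antipode to the opposite one. *)
Lemma isomorphic_cross : affinely_isomorphic P (cross_polytope R d).
Proof.
have [h [hI hK hN hS]] := antipodal_index.
have sKr := symdiffKr B.
have h'K i : symdiff (h i) B \in K by rewrite symdiff_closedl.
have dR : d%:R != 0 :> R by rewrite pnatr_eq0 -lt0n.
have sumK (W' : nmodType) (phi : {set E} -> W') :
    \sum_(A in K) phi A = \sum_i (phi (h i) + phi (symdiff (h i) B)).
  have dis : [disjoint h @: [set: 'I_d]%SET & (fun i => symdiff (h i) B) @: [set: 'I_d]%SET].
    rewrite finset.disjoints_subset; apply/fintype.subsetP => _ /imsetP[i _ ->].
    rewrite finset.inE; apply/imsetP => -[j _ ij]; move: (hN i j).
    by rewrite ij eqxx.
  rewrite (eq_bigl [predU h @: [set: 'I_d]%SET & (fun i => symdiff (h i) B) @: [set: 'I_d]%SET]).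
    rewrite bigU//= big_imset/=; last by move=> i j _ _ /hI.
    rewrite big_imset/=; last by move=> i j _ _ /(inv_inj sKr)/hI.
    rewrite big_split/=; congr (_ + _); apply: eq_bigl => i; exact: finset.in_setT.
  move=> A; rewrite !inE; apply/idP/orP => [/hS[i [->|->]]|[]/imsetP[i _ ->]//].
  - by left; exact: imset_f.
  - by right; apply: (imset_f (fun i => symdiff (h i) B)).
pose eta i A : R := (A == h i)%:R - (A == symdiff (h i) B)%:R.
have eta_h i j : eta i (h j) = (i == j)%:R.
  by rewrite /eta (negPf (hN j i)) subr0 (inj_eq hI) eq_sym.
have eta_h' i j : eta i (symdiff (h j) B) = - (i == j)%:R.
  rewrite /eta [_ == h i]eq_sym (negPf (hN i j)) sub0r (inj_eq (inv_inj sKr)).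
  by rewrite (inj_eq hI) eq_sym.
have eta_sgn i A : A \in K ->
    \sum_(e in S) sgn e (h i) * sgn e A = d%:R * eta i A.
  move=> AK; rewrite (eq_bigr (fun e => sgn e (symdiff A (h i)))); last first.
    by move=> e _; rewrite sgn_symdiff mulrC.
  by rewrite sum_sgn_antipodal ?symdiff_closedl// !symdiff_eqr symdiff0.
(* The matrix of the signs of the [h i] is a Hadamard matrix, whose transpose
   inverts the map. *)
have recover e A : e \in S -> A \in K -> \sum_i sgn e (h i) * eta i A = sgn e A.
  move=> eS AK; have [j AE] := hS _ AK.
  rewrite (bigD1 j)//= big1 ?addr0 => [|i /negPf ij].
    by case: AE => ->; rewrite ?eta_h ?eta_h' ?sgnB// eqxx ?mulr1// mulrN1.
  by case: AE => ->; rewrite ?eta_h ?eta_h' ij ?oppr0 mulr0.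
pose a (i : 'I_d) e : R := if e \in S then - 2 / d%:R * sgn e (h i) else 0.
pose b : W := [ffun i => d%:R^-1 * \sum_(e in S) sgn e (h i) : R].
have fchar i A : A \in K -> (coord_map a (char A) + b) i = eta i A.
  move=> AK; rewrite !ffunE /dotp.
  rewrite [X in X + _](_ : _ = d%:R^-1 * \sum_(e in S)
      (sgn e (h i) * sgn e A - sgn e (h i))).
    by rewrite -mulrDr sumrB subrK eta_sgn// mulKf.
  rewrite mulr_sumr [RHS]big_mkcond; apply: eq_bigr => e _; rewrite /a char_sgn.
  by case: ifP => _; rewrite ?mul0r//; field.
have fsum (w : {set E} -> R) i : \sum_(A in K) w A = 1 ->
    (coord_map a (\sum_(A in K) w A *: char A) + b) i =
    \sum_(A in K) w A * eta i A.
  move=> w1; rewrite affine_comb// sum_ffunE; apply: eq_bigr => A AK.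
  by rewrite ffunE fchar.
exists (coord_map a), b; split.
- move=> v /convex_hullP[w [w0 w1 ->]]; apply/cross_norm.
  rewrite (eq_bigr (fun i => `|w (h i) - w (symdiff (h i) B)|)); last first.
    move=> i _; rewrite fsum// sumK; congr (`| _ |).
    rewrite (bigD1 i)//= big1 ?addr0 => [|j ji].
      by rewrite eta_h eta_h' eqxx mulr1 mulrN1.
    by rewrite eta_h eta_h' eq_sym (negPf ji) oppr0 !mulr0 addr0.
  rewrite -w1 sumK; apply: ler_sum => i _.
  have := w0 _ (hK i); have := w0 _ (h'K i).
  by rewrite ler_norml => x1 x2; apply/andP; split; lra.
- move=> v v' /set_mem Pv /set_mem Pv' /= vv'; apply: eq_on_hull => // e eS.
  have coord u : P u -> u e = (1 - \sum_i sgn e (h i) * (coord_map a u + b) i) / 2.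
    move=> /convex_hullP[w [_ w1 ->]].
    under [X in 1 - X]eq_bigr do rewrite fsum// mulr_sumr.
    rewrite exchange_big/= sum_char_coord.
    rewrite [X in 1 - X](eq_bigr (fun A => w A * sgn e A)); last first.
      move=> A AK; rewrite -(recover e A eS AK) mulr_sumr.
      by apply: eq_bigr => i _; rewrite mulrCA.
    transitivity ((\sum_(A in K) w A - \sum_(A in K) w A * sgn e A) / 2).
      2: by rewrite w1.
    rewrite -sumrB mulr_suml; apply: eq_bigr => A _.
    by rewrite char_sgn; field.
  by rewrite !coord// vv'.
move=> y /cross_norm y1.
pose r : R := (1 - \sum_i `|y i : R|) / (2 * d%:R).
have r0 : 0 <= r by rewrite divr_ge0 ?subr_ge0// mulr_ge0// ler0n.
(* [y i] is realized on the pair of [h i] with the least possible weight, and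
   the remaining weight is spread evenly over all the points. *)
pose w A : R := r + \sum_i (`|y i : R| * (eta i A * eta i A) + (y i : R) * eta i A) / 2.
have wE A j s : A \in K -> (forall i, eta i A = (i == j)%:R * s) -> s * s = 1 ->
    w A = r + (`|y j : R| + (y j : R) * s) / 2.
  move=> AK AE s1; rewrite /w; congr (_ + _).
  rewrite (bigD1 j)//= big1 ?addr0 => [|i /negPf ij].
    by rewrite AE eqxx mul1r s1 mulr1.
  by rewrite AE ij !mul0r !mulr0 addr0 mul0r.
have wh j : w (h j) = r + (`|y j : R| + (y j : R)) / 2.
  rewrite (@wE _ j 1) ?mulr1// => i; rewrite eta_h mulr1//.
have wh' j : w (symdiff (h j) B) = r + (`|y j : R| - (y j : R)) / 2.
  by rewrite (@wE _ j (-1)) ?mulrN1 ?opprK// => i; rewrite eta_h' mulrN1.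
have w1 : \sum_(A in K) w A = 1.
  rewrite sumK (eq_bigr (fun i => 2 * r + `|y i : R|)); last first.
    by move=> i _; rewrite wh wh'; field.
  rewrite big_split/= sumr_const card_ord -mulr_natr /r; field.
  exact: dR.
exists (\sum_(A in K) w A *: char A).
  apply/convex_hullP; exists w; split=> // A /hS[i [->|->]].
    by rewrite wh; have := ler_norm (- (y i : R)); rewrite normrN; lra.
  by rewrite wh'; have := ler_norm (y i : R); lra.
apply/ffunP => i; rewrite fsum// sumK (bigD1 i)//= big1 ?addr0 => [|j ji].
  by rewrite eta_h eta_h' eqxx wh wh' /= mulr1 mulrN1; field.
by rewrite eta_h eta_h' eq_sym (negPf ji) oppr0 !mulr0 addr0.
Qed.

End Cross.
End Isomorphisms.

Section Converse.
Variables (R : realType) (E : finType) (K : {set {set E}}) (S : {set E}).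
Hypotheses (KD : symdiff_closed K) (Srep : represents K S).

Local Notation V := {ffun E -> R^o}.
Local Notation char := (@char_vector R E).
Local Notation P := (convex_hull (points K char)).
Local Notation sgn := (@parity_char R E).
Local Notation ind := (@indicator R {set E}).
Local Notation d := #|S|.
Local Notation W := {ffun 'I_d -> R^o}.

(** A preimage of [q] in the polytope is a combination of points [A] of [K] with
    [f (char A) + b] in [Q]; the functional [l] is maximal at all of them that
    carry weight. *)
Lemma exposed_vertex (Q : set W) (f : {linear V -> W}) (b : W)
    (l : {scalar W}) (q : W) :
  set_bij P Q (fun x => f x + b) -> Q q -> (forall y, Q y -> l y <= l q) ->
  (forall y, Q y -> l y = l q -> y = q) ->
  exists2 A, A \in K & f (char A) + b = q.
Proof.
move=> [fun_f _ surj_f] Qq lq leq; have [v Pv /= vq] := surj_f _ Qq.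
have /convex_hullP[w [w0 w1 vE]] := Pv.
have QA A : A \in K -> Q (f (char A) + b).
  by move=> AK; apply: fun_f; exact: convex_hull_point.
have [A AK wA] : exists2 A, A \in K & w A != 0.
  apply/exists_inP; apply: contraT; rewrite negb_exists_in => /forall_inP w00.
  have := oner_neq0 R; rewrite -w1 big1 ?eqxx// => A /w00.
  by rewrite negbK => /eqP.
exists A => //; apply: leq; first exact: QA.
have sum0 : \sum_(A in K) w A * (l q - l (f (char A) + b)) = 0.
  rewrite (eq_bigr (fun A => w A * l q - w A * l (f (char A) + b))).
    rewrite sumrB -mulr_suml w1 mul1r -vq vE affine_comb// linear_sum.
    by apply/eqP; rewrite subr_eq0; apply/eqP/eq_bigr => B _; rewrite linearZ.
  by move=> B _; rewrite mulrBr.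
have ge0 B : B \in K -> 0 <= w B * (l q - l (f (char B) + b)).
  by move=> BK; rewrite mulr_ge0 ?w0// subr_ge0; apply/lq/QA.
have /eqP := psumr_eq0P ge0 sum0 AK.
by rewrite mulf_eq0 (negPf wA) subr_eq0 => /eqP ->.
Qed.

Lemma cube_vertices : affinely_isomorphic P (cube R d) -> (2 ^ d <= #|K|)%N.
Proof.
move=> [f [b fbij]].
pose q (s : {ffun 'I_d -> bool}) : W := [ffun i => (-1) ^+ s i].
have /choice[h hP] : forall s, exists A, A \in K /\ f (char A) + b = q s.
  move=> s; suff [A AK AE] : exists2 A, A \in K & f (char A) + b = q s by exists A.
  have s1 i : (-1) ^+ s i = 1 :> R \/ (-1) ^+ s i = -1 :> R.
    by case: (s i); [right; rewrite expr1|left; rewrite expr0].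
  have term (y : W) i : cube R d y ->
      ((-1) ^+ s i : R) * y i <= ((-1) ^+ s i : R) * (q s) i.
    move=> /(_ i) /andP[y1 y2]; rewrite ffunE.
    by case: (s1 i) => ->; lra.
  apply: (exposed_vertex (l := dotp (fun i => (-1) ^+ s i)) fbij).
  - by move=> i; rewrite ffunE; apply/andP; case: (s1 i) => ->; split; lra.
  - by move=> y yc; apply: ler_sum => i _; exact: term.
  move=> y yc yE; apply/ffunP => i.
  have ge0 (j : 'I_d) : true -> 0 <= ((-1) ^+ s j : R) * (q s) j - ((-1) ^+ s j : R) * y j.
    by move=> _; rewrite subr_ge0 term.
  have sum0 : \sum_j (((-1) ^+ s j : R) * (q s) j - ((-1) ^+ s j : R) * y j) = 0.
    by rewrite sumrB; apply/eqP; rewrite subr_eq0; apply/eqP/esym; exact: yE.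
  have := psumr_eq0P ge0 sum0 (i := i) isT.
  by rewrite ffunE; case: (s1 i) => ->; lra.
have hI : injective h.
  move=> s s' ss'; have [_ e1] := hP s; have [_] := hP s'.
  rewrite -ss' e1 => /ffunP qq; apply/ffunP => i; have := qq i; rewrite !ffunE.
  exact: signr_inj.
rewrite -[d in (2 ^ d)%N]card_ord -card_bool -card_ffun -cardsT -(card_imset _ hI).
by apply/subset_leq_card/fintype.subsetP => _ /imsetP[s _ ->]; have [] := hP s.
Qed.

(** The facets are given by the membership or not of an element of [S]. An affine
    function vanishing on one of them does not depend on the other elements of
    [S], as these can be toggled separately within [K]. *)
Lemma cube_facets : #|K| = (2 ^ d)%N -> (2 * d <= #|facet_family R K S|)%N.
Proof.
move=> cK; have KS : traces K S = powerset S.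
  apply/eqP; rewrite finset.eqEcard card_powerset (card_traces Srep) cK leqnn andbT.
  by apply/fintype.subsetP => _ /imsetP[A _ ->]; rewrite finset.inE finset.subsetIr.
have flip e : e \in S -> exists2 A, A \in K & forall e', e' \in S -> (e' \in A) = (e' == e).
  move=> eS; have : [set e]%SET \in powerset S by rewrite finset.inE finset.sub1set.
  rewrite -KS => /imsetP[A AK /finset.setP eA]; exists A => // e' e'S.
  by have := eA e'; rewrite !finset.inE e'S andbT.
have onoff e (c : bool) : e \in S ->
    [set A in K | (e \in A) == c]%SET \in facet_family R K S.
  move=> eS; rewrite finset.inE; set Z := [set _ in _ | _]%SET.
  have ZE A : A \in K -> (A \in Z) = ((e \in A) == c).
    by move=> AK; rewrite finset.inE AK.
  have [A0 A0K A0E] := flip _ eS.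
  have sE A : sgn e A = (-1) ^+ c \/ sgn e A = - (-1) ^+ c.
    by rewrite /parity_char; case: (e \in A); case: (c) => /=; rewrite ?expr0 ?expr1 ?opprK; auto.
  have indE A : A \in K -> ind Z A = (1 + (-1) ^+ c * sgn e A) / 2.
    move=> AK; rewrite /indicator ZE// /parity_char.
    by case: (e \in A); case: (c) => /=; rewrite ?expr0 ?expr1; field.
  apply/and3P; split.
  - apply/boolspanP; split.
      by apply/fintype.subsetP => A; rewrite finset.inE => /andP[].
    apply: (@affspan_ext _ _ _ _ _ _ (fun A => 2^-1 * ((-1) ^+ c * sgn e A + 1))).
      by move=> A AK; rewrite indE// mulrC addrC.
    apply/affspanZ/affspan_comb; [exact: affspan_gen|exact: affspan_const].
  - apply/set0Pn; exists (if c then A0 else finset.set0).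
    case: (c) ZE => ZE; first by rewrite ZE// A0E// eqxx.
    by rewrite ZE ?KD.1// finset.inE.
  apply/asboolP => g [a0 [a gE]] g0.
  have {}g0 A : A \in K -> (e \in A) = ~~ c -> g A = 0.
    by move=> AK eA; apply: g0 => //; rewrite ZE// eA; case: (c).
  have [A1 A1K A1E] : exists2 A1, A1 \in K & (e \in A1) = ~~ c.
    case: (c); first by exists finset.set0; [exact: KD.1|rewrite finset.inE].
    by exists A0; rewrite ?A0E ?eqxx.
  have a_eq0 e' : e' \in S -> e' != e -> a e' = 0.
    move=> e'S e'e; have [B BK BE] := flip _ e'S.
    have ABK : symdiff A1 B \in K by rewrite symdiff_closedl.
    have : g A1 - g (symdiff A1 B) = 0.
      rewrite !g0 ?subrr// in_symdiff A1E BE// eq_sym (negPf e'e).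
      by rewrite addbF.
    rewrite !gE// opprD addrACA subrr add0r -sumrB (bigD1 e')//= big1 ?addr0.
      have sB : sgn e' B = -1 by rewrite /parity_char BE// eqxx expr1.
      rewrite sgn_symdiff sB.
      move=> h; have {}h : a e' * sgn e' A1 = 0 by lra.
      by move/eqP: h; rewrite mulf_eq0 signr_eq0 orbF => /eqP.
    move=> e'' /andP[e''S /negPf e''e'].
    have sB : sgn e'' B = 1 by rewrite /parity_char BE// e''e' expr0.
    by rewrite sgn_symdiff sB mulr1 subrr.
  have {}gE A : A \in K -> g A = a0 + a e * sgn e A.
    move=> AK; rewrite gE// (bigD1 e)//= big1 ?addr0// => e' /andP[e'S e'e].
    by rewrite a_eq0// mul0r.
  have := g0 _ A1K A1E; rewrite gE// /parity_char A1E signrN => a0E.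
  exists (2 * a0) => A AK; rewrite gE// indE//.
  have -> : a0 = a e * (-1) ^+ c by lra.
  have c1 : (-1) ^+ c * (-1) ^+ c = 1 :> R by rewrite -signr_addb addbb.
  rewrite [RHS](_ : _ = a e * (-1) ^+ c + a e * ((-1) ^+ c * (-1) ^+ c) * sgn e A).
    by rewrite c1 mulr1.
  by field.
pose F (x : E * bool) := [set A in K | (x.1 \in A) == x.2]%SET.
have FI : {in finset.setX S [set: bool]%SET &, injective F}.
  move=> [e c] [e' c']; rewrite !finset.inE !andbT /= => eS e'S /finset.setP FF.
  have cc' : c = c'.
    have := FF finset.set0; rewrite !finset.inE KD.1.
    by case: (c); case: (c').
  rewrite -cc' in FF *; congr (_, _); apply: (Srep.1).2 => // A AK.
  have := FF A; rewrite !finset.inE AK /=.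
  by case: (e \in A); case: (e' \in A); case: (c).
have <- : #|finset.setX S [set: bool]%SET| = (2 * d)%N.
  by rewrite finset.cardsX cardsT card_bool mulnC.
rewrite -(card_in_imset FI); apply/subset_leq_card/fintype.subsetP.
move=> _ /imsetP[[e c] + ->]; rewrite finset.in_setX => /andP[eS _].
exact: onoff.
Qed.

(** For every choice of a vertex in each antipodal pair there is an affine function
    equal to 1 at these and to 0 at the others. Since all the antipodal pairs have
    the same midpoint, an affine function vanishing at the latter is constant on
    the former. *)
Lemma cross_vertices_facets : S != finset.set0 ->
  affinely_isomorphic P (cross_polytope R d) ->
  (2 * d <= #|K|)%N /\ (2 ^ d <= #|facet_family R K S|)%N.
Proof.
move=> S0 [f [b fbij]]; have [fun_f inj_f surj_f] := fbij.
have d0 : (0 < d)%N by rewrite card_gt0.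
pose sg (c : bool) : R := (-1) ^+ c.
have sg1 c : sg c = 1 \/ sg c = -1.
  by case: c; rewrite /sg; [right; rewrite expr1|left; rewrite expr0].
have sgsq c : sg c * sg c = 1 by rewrite /sg -signr_addb addbb.
pose q i c : W := [ffun j => (j == i)%:R * sg c].
have sumq i c : \sum_j `|q i c j : R| = 1.
  rewrite (bigD1 i)//= big1 ?addr0 => [|j /negPf ji].
    by rewrite ffunE eqxx mul1r; case: (sg1 c) => ->; rewrite ?normrN normr1.
  by rewrite ffunE ji mul0r normr0.
have Qq i c : cross_polytope R d (q i c) by apply/cross_norm; rewrite sumq.
have /choice[h hP] : forall ic : 'I_d * bool, exists A,
    A \in K /\ f (char A) + b = q ic.1 ic.2.
  move=> [i c] /=; suff [A AK AE] : exists2 A, A \in K & f (char A) + b = q i c.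
    by exists A.
  have lE (y : W) : dotp (fun j => (j == i)%:R * sg c) y = sg c * y i.
    rewrite /dotp (bigD1 i)//= big1 ?addr0 => [|j /negPf ji].
      by rewrite eqxx mul1r.
    by rewrite ji !mul0r.
  have qi : (q i c) i = sg c by rewrite ffunE eqxx mul1r.
  have le_norm (y : W) : sg c * y i <= `|y i : R|.
    have := ler_norm (y i : R); have := ler_norm (- (y i : R)); rewrite normrN.
    by case: (sg1 c) => ->; lra.
  have split_i (y : W) : \sum_j `|y j : R| = `|y i : R| + \sum_(j | j != i) `|y j : R|.
    by rewrite (bigD1 i).
  have rest0 (y : W) : 0 <= \sum_(j | j != i) `|y j : R| by apply: sumr_ge0.
  apply: (exposed_vertex (l := dotp (fun j => (j == i)%:R * sg c)) fbij) => //.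
    move=> y /cross_norm y1; rewrite /= !lE qi sgsq.
    have := split_i y; have := rest0 y; have := le_norm y; lra.
  move=> y /cross_norm y1; rewrite /= !lE qi sgsq => yi.
  have yr : \sum_(j | j != i) `|y j : R| = 0.
    by have := split_i y; have := rest0 y; have := le_norm y; lra.
  apply/ffunP => j; rewrite ffunE; have [->|ji] := eqVneq j i.
    by rewrite mul1r -[LHS]mul1r -(sgsq c) -mulrA yi mulr1.
  have ge0 (k : 'I_d) : k != i -> 0 <= `|y k : R| by [].
  by rewrite mul0r; apply/eqP; rewrite -normr_eq0 (psumr_eq0P ge0 yr ji).
have hK ic : h ic \in K by have [] := hP ic.
have hE ic : f (char (h ic)) + b = q ic.1 ic.2 by have [] := hP ic.
have hI : injective h.
  move=> [i c] [i' c'] ii'; have := hE (i, c); rewrite ii' hE /= => /ffunP qq.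
  have := qq i'; rewrite !ffunE eqxx mul1r; case: eqVneq => [->|_].
    by rewrite mul1r /sg => /signr_inj ->.
  by rewrite mul0r => /eqP; rewrite signr_eq0.
have hS A : A \in K -> exists ic, A = h ic.
  move=> AK; pose y : W := f (char A) + b.
  have PA : P (char A) by exact: convex_hull_point.
  have /cross_norm y1 : cross_polytope R d y by exact: fun_f.
  pose r : R := (1 - \sum_i `|y i : R|) / (2 * d%:R).
  have dR : d%:R != 0 :> R by rewrite pnatr_eq0 -lt0n.
  have r0 : 0 <= r by rewrite divr_ge0 ?subr_ge0// mulr_ge0// ler0n.
  pose w (ic : 'I_d * bool) : R := r + (`|y ic.1 : R| + (y ic.1 : R) * sg ic.2) / 2.
  have w1 : \sum_(ic in [set: 'I_d * bool]%SET) w ic = 1.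
    rewrite (eq_bigl xpredT) => [|ic]; last by rewrite finset.in_setT.
    rewrite -(pair_bigA _ (fun i c => w (i, c)))/=.
    rewrite (eq_bigr (fun i => 2 * r + `|y i : R|)) => [|i _]; last first.
      by rewrite big_bool /w /sg /= expr0 expr1; field.
    rewrite big_split/= sumr_const card_ord -mulr_natr /r; field.
    exact: dR.
  pose u := \sum_(ic in [set: 'I_d * bool]%SET) w ic *: char (h ic).
  have wge0 ic : 0 <= w ic.
    rewrite /w; have := ler_norm (y ic.1 : R); have := ler_norm (- (y ic.1 : R)).
    by rewrite normrN; case: (sg1 ic.2) => ->; lra.
  have hu : convex_hull (points [set: 'I_d * bool]%SET (char \o h)) u.
    by apply/convex_hullP; exists w; split=> // ic _; exact: wge0.
  have Pu : P u.
    by apply: convex_hull_mono hu => x [ic _ <-]; exists (h ic) => //=.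
  have fu : f u + b = y.
    rewrite /u affine_comb//; apply/ffunP => i; rewrite sum_ffunE.
    rewrite (eq_bigl xpredT) => [|ic]; last by rewrite finset.in_setT.
    rewrite (eq_bigr (fun ic : 'I_d * bool => w (ic.1, ic.2) * ((i == ic.1)%:R * sg ic.2))) => [|ic _]; last first.
      by rewrite hE !ffunE; case: ic.
    rewrite -(pair_bigA _ (fun j c => w (j, c) * ((i == j)%:R * sg c)))/=.
    rewrite (bigD1 i)//= [X in _ + X]big1 ?addr0 => [|j /negPf ji].
      by rewrite big_bool eqxx /w /sg /= expr0 expr1; field.
    by rewrite big1// => c _; rewrite eq_sym ji mul0r mulr0.
  have uA : u = char A.
    by apply: inj_f; [exact/mem_set|exact/mem_set|].
  have : convex_hull (points [set h ic | ic in [set: 'I_d * bool]%SET]%SET char)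
      (char A).
    rewrite -uA; apply: convex_hull_mono hu => x [ic _ <-].
    by exists (h ic) => //=; exact: imset_f.
  by move=> /convex_hull_char/imsetP[ic _ ->]; exists ic.
split.
  have <- : #|[set: 'I_d * bool]%SET| = (2 * d)%N.
    by rewrite cardsT card_prod card_bool card_ord mulnC.
  rewrite -(card_imset _ hI).
  by apply/subset_leq_card/fintype.subsetP => _ /imsetP[ic _ ->].
have coordE i : exists a : E -> R, forall v, f v i = dotp a v by exact: linear_coord.
have spanY i : affspan sgn K S (fun A => (f (char A) + b) i : R).
  have [a aE] := coordE i; apply/(affspan_affine Srep); exists (b i), a => A _.
  by rewrite ffunE aE addrC.
pose Zs (t : {ffun 'I_d -> bool}) := [set h (i, t i) | i : 'I_d]%SET.
have inZ t i c : (h (i, c) \in Zs t) = (c == t i).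
  apply/imsetP/eqP => [[j _ /hI[-> ->]]//|->]; by exists i.
have ZsF t : Zs t \in facet_family R K S.
  have indE A : A \in K ->
      ind (Zs t) A = 2^-1 * (1 + \sum_i sg (t i) * (f (char A) + b) i).
    move=> /hS[[i c] ->]; rewrite /indicator inZ.
    rewrite (bigD1 i)//= big1 ?addr0 => [|j /negPf ji].
      rewrite hE ffunE eqxx mul1r /sg; case: (c); case: (t i) => /=;
      by rewrite ?expr0 ?expr1; field.
    by rewrite hE ffunE ji mul0r mulr0.
  rewrite finset.inE; apply/and3P; split.
  - apply/boolspanP; split.
      by apply/fintype.subsetP => _ /imsetP[i _ ->].
    apply: (@affspan_ext _ _ _ _ _ _
      (fun A => 2^-1 * (1 + \sum_i sg (t i) * (f (char A) + b) i))).
      by move=> A AK; rewrite indE.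
    apply/affspanZ/affspanD; first exact: affspan_const.
    by apply: affspan_sum => i _; apply/affspanZ/spanY.
  - by apply/set0Pn; exists (h (Ordinal d0, t (Ordinal d0))); rewrite inZ.
  apply/asboolP => g /(affspan_affine Srep)[g0 [a gE]] gz.
  pose mid i : V := 2^-1 *: char (h (i, true)) + 2^-1 *: char (h (i, false)).
  have half : 2^-1 + 2^-1 = 1 :> R by field.
  have Pmid i : P (mid i).
    by apply: convex_hull_midpoint; exact: convex_hull_point.
  have fmid i : f (mid i) + b = 0.
    have : f (mid i) + b = 2^-1 *: (f (char (h (i, true))) + b) +
                          2^-1 *: (f (char (h (i, false))) + b).
      rewrite linearD/= !linearZ/= !scalerDr addrACA -scalerDl half.
      by rewrite scale1r.
    move=> ->; rewrite !hE; apply/ffunP => j; rewrite !ffunE /= /sg expr0 expr1.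
    by rewrite /GRing.scale/=; ring.
  have midE i j : mid i = mid j.
    apply: inj_f; [exact/mem_set|exact/mem_set|].
    by rewrite !fmid.
  have gmid i : g (h (i, true)) + g (h (i, false)) = 2 * (g0 + dotp a (mid i)).
    by rewrite !gE// /mid linearD/= !linearZ/=; field.
  pose i0 := Ordinal d0.
  exists (2 * (g0 + dotp a (mid i0))) => A /hS[[i c] ->].
  rewrite (midE i0 i) -gmid /indicator inZ.
  have gN : g (h (i, ~~ t i)) = 0.
    by apply: gz => //; rewrite inZ; case: (t i).
  by case: (c) (t i) gN => -[] /= gN; rewrite ?mulr1n ?mulr0n ?mulr1 ?mulr0 ?gN ?addr0 ?add0r.
have ZsI : injective Zs.
  move=> t t' tt'; apply/ffunP => i.
  by have := inZ t' i (t i); rewrite -tt' inZ eqxx => /esym/eqP.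
rewrite -[d in (2 ^ d)%N]card_ord -card_bool -card_ffun -cardsT -(card_imset _ ZsI).
by apply/subset_leq_card/fintype.subsetP => _ /imsetP[t _ ->]; exact: ZsF.
Qed.

End Converse.

Lemma cycle_polytopeE (R : realType) (E : finType) (I : {set {set E}}) :
  cycle_polytope R I =
  convex_hull (points (cycle_space I) (@char_vector R E)).
Proof.
congr convex_hull; apply/seteqP; split=> v /= [C Cc <-]; exists C => //.
  exact/cycle_spaceP.
exact/cycle_spaceP.
Qed.

Theorem lemma35 (R : realType) (E : finType) (M : matroid E) (d : nat)
  (M_binary : binary M)
  (M_noF7dual : ~ has_minor M (matroid_dual F7))
  (M_noR10 : ~ has_minor M R10)
  (M_noK5dual : ~ has_minor M (matroid_dual (MK 5)))
  (P_two_level : two_level (cycle_polytope R M))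
  (P_dim : has_dim (cycle_polytope R M) d) :
  (num_vertices (cycle_polytope R M) * num_facets (cycle_polytope R M)
     <= d * 2 ^ d.+1)%N /\
  ((num_vertices (cycle_polytope R M) * num_facets (cycle_polytope R M)
     = d * 2 ^ d.+1)%N <->
   affinely_isomorphic (cycle_polytope R M) (cube R d) \/
   affinely_isomorphic (cycle_polytope R M) (cross_polytope R d)).
Proof.
rewrite cycle_polytopeE in P_two_level P_dim *.
have KD := symdiff_closed_cycles M_binary.
set K := cycle_space M in KD P_two_level P_dim *.
have [S Srep] := represents_exist K.
have dE := has_dim_uniq (has_dim_hull R KD Srep) P_dim.
rewrite -dE num_vertices_char.
have [S0|S0] := eqVneq S finset.set0.
  have d0 : d = 0%N by rewrite -dE S0 cards0.
  have -> : num_facets (convex_hull (points K (@char_vector R E))) = 0%N.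
    rewrite /num_facets (_ : [set _ | _]%classic = set0) ?fset_set0 ?cardfs0//.
    apply/seteqP; split=> // F /= [_ [k _ Pk]].
    by have := has_dim_uniq Pk P_dim; rewrite d0.
  rewrite S0 cards0 muln0 mul0n; split=> //; split=> // _; left.
  have := isomorphic_cube R Srep; rewrite S0 cards0; apply.
  by rewrite -(card_traces Srep) S0 card_traces_set0 ?KD.1.
rewrite (num_facets_family KD Srep S0 P_two_level) mulnC -(card_traces Srep).
have [bound tight] := facet_traces_bound R KD Srep.1 S0.
split=> //; split.
  move=> /(facet_traces_tight KD Srep.1 S0)[full|anti].
    by left; apply: isomorphic_cube => //; rewrite -(card_traces Srep).
  have [[B BK SB] _] := anti.
  by right; exact: (isomorphic_cross KD Srep S0 anti BK SB).
move=> iso; apply/eqP; rewrite eqn_leq bound /=.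
case: iso => [/(cube_vertices)|/(cross_vertices_facets Srep S0)[leK leF]].
  move=> leK; have cK : #|traces K S| = (2 ^ #|S|)%N.
    apply/eqP; rewrite eqn_leq card_traces_leq (card_traces Srep) leK//.
  have leF := cube_facets R KD Srep; rewrite -(card_traces Srep) cK in leF.
  by rewrite cK expnS mulnA leq_mul2r (mulnC _ 2%N) leF// orbT.
rewrite (card_traces Srep).
apply: leq_trans (leq_mul leF leK); rewrite expnS; lia.
Qed.
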